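(* Let $1\le s\le d$ be integers. The function class $\mathcal{F}^{d,s}_{\infty\text{-mars}}$ consists precisely of all the functions $f:[0,1]^d\to\mathbb{R}$ of the form $$f(x_1,\dots,x_d)=a_{\mathbf 0}+\sum_{\substack{\alpha\in\{0,1\}^d\setminus\{\mathbf 0\}\\|\alpha|\le s}}\int_{[\mathbf 0,x^{(\alpha)}]}g_\alpha(t^{(\alpha)})\,dt^{(\alpha)}\qquad(\ast)$$ for some $a_{\mathbf 0}\in\mathbb{R}$ and some collection of functions $\{g_\alpha:\alpha\in\{0,1\}^d\setminus\{\mathbf 0\},\ |\alpha|\le s\}$, where for each such $\alpha$: (i) $g_\alpha$ is a real-valued function on $[0,1]^{|\alpha|}$; (ii) $V_{\text{HK0}}(g_\alpha)<\infty$; (iii) $g_\alpha$ is coordinate-wise right-continuous on $[0,1]^{|\alpha|}$; and (iv) $g_\alpha$ is coordinate-wise left-continuous at each point $x^{(\alpha)}=(x_j,\ j\in S(\alpha))\in[0,1]^{|\alpha|}\setminus[0,1)^{|\alpha|}$ with respect to all the $j$-th coordinates where $x_j=1$. Furthermore, the complexity of $f$ in $(\ast)$ can be written as $$V_{\text{mars}}(f)=\sum_{\substack{\alpha\in\{0,1\}^d\setminus\{\mathbf 0\}\\|\alpha|\le s}}V_{\text{HK0}}(g_\alpha).$$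
   Context: $[m]=\{1,\dots,m\}$, $u_+=\max\{u,0\}$, $\mathbf 0=(0,\dots,0)$. For $\alpha\in\{0,1\}^d$ put $S(\alpha)=\{j\in[d]:\alpha_j=1\}$ and $|\alpha|=|S(\alpha)|$; $t^{(\alpha)}=(t_j,\ j\in S(\alpha))$ and $x^{(\alpha)}=(x_j,\ j\in S(\alpha))$; $[u,v]$ denotes the closed axis-aligned rectangle $\prod_i[u_i,v_i]$. For $a_{\mathbf 0}\in\mathbb{R}$ and a collection $\{\nu_\alpha\}$ in which, for each $\alpha\in\{0,1\}^d\setminus\{\mathbf 0\}$ with $|\alpha|\le s$, $\nu_\alpha$ is a finite (Borel) signed measure on $[0,1)^{|\alpha|}$ (coordinates indexed by $S(\alpha)$), define on $[0,1]^d$ $$f_{a_{\mathbf 0},\{\nu_\alpha\}}(x_1,\dots,x_d)=a_{\mathbf 0}+\sum_{\substack{\alpha\in\{0,1\}^d\setminus\{\mathbf 0\}\\|\alpha|\le s}}\int_{[0,1)^{|\alpha|}}\prod_{j\in S(\alpha)}(x_j-t_j)_+\,d\nu_\alpha(t^{(\alpha)}).$$ $\mathcal{F}^{d,s}_{\infty\text{-mars}}$ is the class of all such functions. The complexity of $f=f_{a_{\mathbf 0},\{\nu_\alpha\}}$ is $V_{\text{mars}}(f)=\sum_{\alpha\in\{0,1\}^d\setminus\{\mathbf 0\},\,|\alpha|\le s}|\nu_\alpha|\big([0,1)^{|\alpha|}\setminus\{\mathbf 0\}\big)$, where $|\nu|$ is the (total) variation measure of $\nu$; this is well defined because $a_{\mathbf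 0}$ and the $\nu_\alpha$ are uniquely determined by $f$. Hardy–Krause variation anchored at $\mathbf 0$. For $g:[0,1]^m\to\mathbb{R}$ the quasi-volume on $[u,v]$ is $\Delta(g;[u,v])=\sum_{\delta\in\{0,1\}^m}(-1)^{\delta_1+\dots+\delta_m}g(v_1+\delta_1(u_1-v_1),\dots,v_m+\delta_m(u_m-v_m))$. An axis-aligned split of $[0,1]^m$ is a collection $\mathcal{P}=\{\prod_{k=1}^m[u^{(k)}_{l_k-1},u^{(k)}_{l_k}]:l_k\in[n_k],\ k\in[m]\}$ with $0=u^{(k)}_0<\dots<u^{(k)}_{n_k}=1$ for each $k$. The Vitali variation is $V^{(m)}(g)=\sup_{\mathcal{P}}\sum_{A\in\mathcal{P}}|\Delta(g;A)|$, the supremum over all axis-aligned splits. For $\alpha\in\{0,1\}^m\setminus\{\mathbf 0\}$ let $\bar T^{(\alpha)}=\prod_k\bar T^{(\alpha)}_k$ with $\bar T^{(\alpha)}_k=[0,1]$ if $\alpha_k=1$ and $\{0\}$ otherwise. Then $V_{\text{HK0}}(g)=\sum_{\alpha\in\{0,1\}^m\setminus\{\mathbf 0\}}V^{(|\alpha|)}(g|_{\bar T^{(\alpha)}})$, where $g|_{\bar T^{(\alpha)}}$ is regarded as a function on $[0,1]^{|\alpha|}$. *)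

(* Defs.v *)
From HB Require Import structures.
From mathcomp Require Import all_boot all_order all_algebra.
From mathcomp Require Import all_classical all_reals all_analysis.

Set Implicit Arguments.
Unset Strict Implicit.
Unset Printing Implicit Defensive.
Import Order.TTheory GRing.Theory Num.Theory.
Import numFieldNormedType.Exports.

Local Open Scope classical_set_scope.
Local Open Scope ring_scope.

(* - A point of R^n is an [n.-tuple R].  As a measurable space R^n is
     [n.-tuple (measurableTypeR R)] (same carrier): [measurableTypeR R] is R with
     its Borel sigma-algebra and tuples carry the product sigma-algebra.
   - A multi-index alpha in {0,1}^d is represented by its support
     S(alpha) : {set 'I_d}, so |alpha| is #|alpha|, and alpha is not 0 iff
     0 < #|alpha|; the coordinates of R^{S(alpha)} are listed by [enum_val].
   - A function on [0,1]^n is a function on R^n of which only the values on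
     [0,1]^n are used. *)

Section rectangles.
Context {R : realType}.

Definition rect n (u v : n.-tuple R) : set (n.-tuple R) :=
  [set t | forall i, tnth u i <= tnth t i <= tnth v i].

Definition tuple0 n : n.-tuple R := [tuple 0 | _ < n].
Definition tuple1 n : n.-tuple R := [tuple 1 | _ < n].

Definition cube n : set (n.-tuple R) := rect (tuple0 n) (tuple1 n).

Definition hcube n : set (n.-tuple R) :=
  [set t | forall i, 0 <= tnth t i < 1].

Definition sub_tuple d (A : {set 'I_d}) (x : d.-tuple R) : #|A|.-tuple R :=
  [tuple tnth x (enum_val i) | i < #|A|].

Definition upd n (x : n.-tuple R) (j : 'I_n) (r : R) : n.-tuple R :=
  [tuple if i == j then r else tnth x i | i < n].

End rectangles.

Arguments cube {R n}.
Arguments hcube {R n}.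

Section lebesgue_measure_on_tuples.
Context {R : realType}.

Definition cons_pair n (p : measurableTypeR R * n.-tuple (measurableTypeR R)) :
  n.+1.-tuple (measurableTypeR R) := [tuple of p.1 :: p.2].

(* Lebesgue measure on R^n, as an iterated product measure. *)
Fixpoint lebesgue_tuple n : set (n.-tuple (measurableTypeR R)) -> \bar R :=
  match n with
  | 0 => dirac ([tuple] : 0.-tuple (measurableTypeR R))
  | n'.+1 => pushforward
               (product_measure1 (@lebesgue_measure R) (@lebesgue_tuple n'))
               (@cons_pair n')
  end.

Lemma measurable_cons_pair n : measurable_fun setT (@cons_pair n).
Proof.
exact: (@measurable_cons _ _
  (measurableTypeR R * n.-tuple (measurableTypeR R))%type (measurableTypeR R)
  fst n snd).
Qed.

Lemma lebesgue_tuple_sigma_finite_measure n :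
  exists m : {sigma_finite_measure set (n.-tuple (measurableTypeR R)) -> \bar R},
    @lebesgue_tuple n = m.
Proof.
elim: n => [|n [m lebE]].
  by exists (dirac ([tuple] : 0.-tuple (measurableTypeR R))).
pose pm : {measure set (measurableTypeR R * n.-tuple (measurableTypeR R))%type
    -> \bar R} := product_measure1 (@lebesgue_measure R) m.
have mf := @measurable_cons_pair n.
pose pf : {measure set (n.+1.-tuple (measurableTypeR R)) -> \bar R} :=
  measure_function_pushforward__canonical__measure_function_Measure pm mf.
pose split_tuple (t : n.+1.-tuple (measurableTypeR R)) :=
  (thead t, [tuple of behead t]).
have ms : measurable_fun setT split_tuple.
  by apply/measurable_fun_pair; [exact: measurable_tnth|exact: measurable_behead].
have sf : sigma_finite setT pf.
  have /sigma_finiteP[F [TF ndF Foo]] := sigma_finiteT (@lebesgue_measure R).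
  have /sigma_finiteP[G [TG ndG Goo]] := sigma_finiteT m.
  exists (fun k => split_tuple @^-1` (F k `*` G k)).
    rewrite -preimage_bigcup [X in _ @^-1` X](_ : _ = setT) ?preimage_setT//.
    rewrite -setXTT TF TG predeqE => -[x y]; split.
      by move=> [k _ [/= ? ?]]; split; exists k.
    move=> [/= [k _ Fkx] [l _ Gly]]; exists (maxn k l) => //; split.
      by move: x Fkx; exact/subsetPset/ndF/leq_maxl.
    by move: y Gly; exact/subsetPset/ndG/leq_maxr.
  move=> k; have [mF Fk] := Foo k; have [mG Gk] := Goo k; split.
    by rewrite -[X in measurable X]setTI; apply: ms => //; exact: measurableX.
  rewrite /= /pushforward -comp_preimage [X in X @^-1` _](_ : _ = idfun).
    by rewrite preimage_id product_measure1E// lte_mul_pinfty// ge0_fin_numE.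
  by apply/funext => -[x t]; congr pair; apply/val_inj.
pose pf_sf := Measure_isSigmaFinite.Build _ _ _ (Measure.sort pf) sf.
pose pfs : {sigma_finite_measure set (n.+1.-tuple (measurableTypeR R)) -> \bar R} :=
  HB.pack (Measure.sort pf) (Measure.class pf) pf_sf.
by exists pfs; rewrite /= lebE.
Qed.

Section instances.
Variable n : nat.

Let lebesgue_tuple0 : @lebesgue_tuple n set0 = 0%E.
Proof.
by have [m ->] := lebesgue_tuple_sigma_finite_measure n; rewrite measure0.
Qed.

Let lebesgue_tuple_ge0 A : (0 <= @lebesgue_tuple n A)%E.
Proof. by have [m ->] := lebesgue_tuple_sigma_finite_measure n. Qed.

Let lebesgue_tuple_semi_sigma_additive :
  semi_sigma_additive (@lebesgue_tuple n).
Proof.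
have [m ->] := lebesgue_tuple_sigma_finite_measure n.
exact: measure_semi_sigma_additive.
Qed.

HB.instance Definition _ := isMeasure.Build _ _ _ (@lebesgue_tuple n)
  lebesgue_tuple0 lebesgue_tuple_ge0 lebesgue_tuple_semi_sigma_additive.

Let sigma_finite_lebesgue_tuple : sigma_finite setT (@lebesgue_tuple n).
Proof.
have [m ->] := lebesgue_tuple_sigma_finite_measure n; exact: sigma_finiteT.
Qed.

HB.instance Definition _ := Measure_isSigmaFinite.Build _ _ _
  (@lebesgue_tuple n) sigma_finite_lebesgue_tuple.

End instances.

End lebesgue_measure_on_tuples.

Section signed_measures.
Context {d : measure_display} {T : measurableType d} {R : realType}.
Implicit Type nu : {charge set T -> \bar R}.

Lemma hahn_pair_ex nu :
  exists PN : set T * set T, hahn_decomposition nu PN.1 PN.2.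
Proof. by have [P [N PN]] := Hahn_decomposition nu; exists (P, N). Qed.

(* Jordan parts do not depend on the chosen Hahn decomposition
   ([Hahn_decomposition_uniq]). *)
Definition hahn_pair nu : hahn_decomposition nu _ _ := svalP (cid (hahn_pair_ex nu)).

Definition total_variation nu : set T -> \bar R :=
  charge_variation (hahn_pair nu).

Definition charge_integral nu (D : set T) (h : T -> R) : R :=
  (\int[jordan_pos (hahn_pair nu)]_(t in D) h t)
  - (\int[jordan_neg (hahn_pair nu)]_(t in D) h t).

(* nu is a signed measure on the measurable set D, extended by 0 outside D *)
Definition carried_by nu (D : set T) :=
  forall B, measurable B -> B `&` D = set0 -> nu B = 0%E.

End signed_measures.

Section hardy_krause.
Context {R : realType}.

Definition quasi_volume m (g : m.-tuple R -> R) (u v : m.-tuple R) : R :=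
  \sum_(D : {set 'I_m}) (-1) ^+ #|D| *
    g [tuple tnth v k + (k \in D)%:R * (tnth u k - tnth v k) | k < m].

(* An axis-aligned split is a family p such that 0 :: p k lists the points
   0 = u^(k)_0 < ... < u^(k)_{n_k} = 1, with n_k = size (p k); a cell is given
   by the choice, for each k, of one of the n_k consecutive intervals. *)
Definition is_split m (p : 'I_m -> seq R) := forall k, itv_partition 0 1 (p k).

Definition split_variation m (g : m.-tuple R -> R) (p : 'I_m -> seq R) : R :=
  \sum_(l : {dffun forall k : 'I_m, 'I_(size (p k))})
    `| quasi_volume g [tuple nth 0 (0 :: p k) (l k) | k < m]
                      [tuple nth 0 (0 :: p k) (l k).+1 | k < m] |.

Definition vitali m (g : m.-tuple R -> R) : \bar R :=
  ereal_sup [set (split_variation g p)%:E | p in @is_split m].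

(* the identification of [0,1]^|B| with the face of [0,1]^m on which the
   coordinates outside B vanish *)
Definition face m (B : {set 'I_m}) (y : #|B|.-tuple R) : m.-tuple R :=
  [tuple if k \in B then nth 0 y (index k (enum B)) else 0 | k < m].

Definition VHK0 m (g : m.-tuple R -> R) : \bar R :=
  (\sum_(B : {set 'I_m} | (0 < #|B|)%N) vitali (fun y => g (@face m B y)))%E.

(* One-sided limits at x_j only involve points of [0,1]^m: right limits are
   taken where x_j < 1 (on [0,1] nothing lies to the right of 1), left limits
   where x_j = 1. *)
Definition coord_right_continuous m (g : m.-tuple R -> R) :=
  forall x : m.-tuple R, cube x -> forall j, tnth x j < 1 ->
    g (upd x j r) @[r --> (tnth x j : R)^'+] --> g x.

Definition coord_left_continuous_at1 m (g : m.-tuple R -> R) :=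
  forall x : m.-tuple R, (cube `\` hcube) x -> forall j, tnth x j = 1 ->
    g (upd x j r) @[r --> (tnth x j : R)^'-] --> g x.

End hardy_krause.

Section mars.
Context {R : realType} {d : nat}.
Variable s : nat.

(* alpha in {0,1}^d \ {0} with |alpha| <= s *)
Definition mars_index (A : {set 'I_d}) : bool := (0 < #|A| <= s)%N.

Definition measure_family :=
  forall A : {set 'I_d}, {charge set (#|A|.-tuple (measurableTypeR R)) -> \bar R}.

Definition admissible_measures (nu : measure_family) :=
  forall A, mars_index A -> carried_by (nu A) hcube.

Definition mars_fun (a0 : R) (nu : measure_family) (x : d.-tuple R) : R :=
  a0 + \sum_(A : {set 'I_d} | mars_index A)
    charge_integral (nu A) hcube
      (fun t => \prod_(i < #|A|)
        Num.max (tnth (sub_tuple A x) i - tnth t i) 0).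

Definition mars_repr (f : d.-tuple R -> R) (a0 : R) (nu : measure_family) :=
  admissible_measures nu /\ forall x, cube x -> f x = mars_fun a0 nu x.

Definition mars_class : set (d.-tuple R -> R) :=
  [set f | exists a0 nu, mars_repr f a0 nu].

Definition mars_complexity (nu : measure_family) : \bar R :=
  (\sum_(A : {set 'I_d} | mars_index A)
    total_variation (nu A) (hcube `\ tuple0 #|A|))%E.

(* V_mars(f) is the complexity of the measures representing f, which f
   determines; the value is junk (0) when f is not in [mars_class]. *)
Definition Vmars (f : d.-tuple R -> R) : \bar R :=
  xget 0%E [set v | exists a0 nu, mars_repr f a0 nu /\ v = mars_complexity nu].

Definition density_family := forall A : {set 'I_d}, #|A|.-tuple R -> R.

Definition admissible_densities (g : density_family) :=
  forall A, mars_index A ->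
    [/\ (VHK0 (g A) < +oo)%E,
        coord_right_continuous (g A) &
        coord_left_continuous_at1 (g A)].

Definition density_repr (f : d.-tuple R -> R) (a0 : R) (g : density_family) :=
  forall x, cube x ->
    f x = a0 + \sum_(A : {set 'I_d} | mars_index A)
      \int[@lebesgue_tuple R #|A|]_(t in rect (tuple0 #|A|) (sub_tuple A x))
        g A t.

End mars.

(* Main.v *)
Require Import Defs.
From HB Require Import structures.
From mathcomp Require Import all_boot all_order all_algebra.
From mathcomp Require Import all_classical all_reals all_analysis measurable_realfun.
From mathcomp Require Import zify ring lra.
Set Implicit Arguments.
Unset Strict Implicit.
Unset Printing Implicit Defensive.
Import Order.TTheory GRing.Theory Num.Theory.
Import numFieldNormedType.Exports.
Local Open Scope classical_set_scope.
Local Open Scope ring_scope.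

(** The functions [g] with properties (ii)-(iv) are the distribution functions
    [x |-> nu [0, x]] of the signed measures [nu] carried by [[0, 1)^m], with
    [V_HK0 g = |nu| ([0, 1)^m \ {0})], and Fubini's theorem turns
    [int prod_i (x_i - t_i)_+ dnu(t)] into [int_[0, x] nu [0, y] dy].

    To construct [nu], fix a face and let [h] be the restriction of [g] to it. The
    variation of [h] over the subcells of a dyadic cell is additive along the tree
    of dyadic cells, hence so are the halves [(variation +- quasi-volume) / 2],
    which are nonnegative. Such a tree of weights is realized by nested intervals;
    the lower corners of the nested cells converge to a random point, whose law
    under the Lebesgue measure is a Jordan part of the measure of that face. Right
    continuity, used in one coordinate at a time, identifies the distribution
    function of the difference of the two laws.

    Conversely [f] determines the [nu_alpha], because difference quotients of
    products of hinge functions converge boundedly to indicators of rectangles. *)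

(** * Quasi-volumes *)

Section finite_combinations.
Context {R : realType}.

(** Continuity is assumed one coordinate at a time, which says nothing directly about moving several
    coordinates together. Every approximation of a point therefore carries a separate level for each
    coordinate, infinity being allowed. Two quantities are compared at finite, possibly unequal
    levels, and the levels are then sent to infinity one by one. Lower corners are used because they
    increase along nested cells: the event that their limit is at most [x] is the intersection of
    the corresponding events at finite levels, and each of these is a union of cells. The two halves
    add up to the variation, so the two laws have total mass at most the Vitali variation. This
    makes the bound on [|nu|] sharp: a Jordan decomposition is minimal among decompositions into
    positive measures, and a signed measure carried by [[0, 1)^m] is determined by its distribution
    function. The opposite bound comes from cells open on the left, which are disjoint within a face
    and across faces. The determination of the measures by [f] proceeds by induction on the number
    of coordinates, because on a face of the cube only the terms of that face and of its subfaces
    survive. *)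

Definition prodf m (phi : 'I_m -> R -> R) (x : m.-tuple R) : R :=
  \prod_(j < m) phi j (tnth x j).

(** Identities between quasi-volumes are linear in the function and involve finitely many of its
    values. They are checked on product functions, where quasi-volumes factor over the coordinates,
    and carried over to all functions by [prod_ext_eq]. *)
Definition fin_comb m (L : (m.-tuple R -> R) -> R) :=
  exists s : seq (R * m.-tuple R), forall g, L g = \sum_(p <- s) p.1 * g p.2.

Lemma fin_comb_eval m (z : m.-tuple R) : fin_comb (fun g => g z).
Proof. by exists [:: (1, z)] => g; rewrite big_seq1 mul1r. Qed.

Lemma fin_combD m (L1 L2 : (m.-tuple R -> R) -> R) :
  fin_comb L1 -> fin_comb L2 -> fin_comb (fun g => L1 g + L2 g).
Proof.
by move=> [s1 h1] [s2 h2]; exists (s1 ++ s2) => g; rewrite big_cat h1 h2.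
Qed.

Lemma fin_combZ m c (L : (m.-tuple R -> R) -> R) :
  fin_comb L -> fin_comb (fun g => c * L g).
Proof.
move=> [s h]; exists [seq (c * p.1, p.2) | p <- s] => g.
by rewrite big_map h mulr_sumr; apply: eq_bigr => p _; rewrite mulrA.
Qed.

Lemma fin_comb_sum m (I : Type) (r : seq I) (P : pred I) c
    (L : I -> (m.-tuple R -> R) -> R) :
  (forall i, fin_comb (L i)) -> fin_comb (fun g => \sum_(i <- r | P i) c i * L i g).
Proof.
move=> h; elim: r => [|i r [s IH]].
  by exists [::] => g; rewrite !big_nil.
have [s' h'] := fin_combZ (if P i then c i else 0) (h i).
exists (s' ++ s) => g; rewrite big_cat/= -h' -IH big_cons.
by case: ifP => // _; rewrite mul0r add0r.
Qed.

(* Every [g] agrees on a finite set with a combination of products of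
   indicators of coordinates. *)
Lemma prod_ext m (L : (m.-tuple R -> R) -> R) : fin_comb L ->
  (forall phi, L (prodf phi) = 0) -> forall g, L g = 0.
Proof.
move=> [s sE] L0 g.
pose ws := undup [seq p.2 | p <- s].
pose phi (w : m.-tuple R) j r := (r == tnth w j)%:R : R.
have prodfE w z : prodf (phi w) z = (z == w)%:R.
  rewrite /prodf /phi; have [->|zw] := eqVneq z w.
    by rewrite big1// => j _; rewrite eqxx.
  have /existsP[j zj] : [exists j, tnth z j != tnth w j].
    apply: contraNT zw; rewrite negb_exists => /forallP h.
    by apply/eqP/eq_from_tnth => j; apply/eqP; rewrite -[_ == _]negbK h.
  by rewrite (bigD1 j)//= (negbTE zj) mul0r.
have gE z : z \in [seq p.2 | p <- s] -> g z = \sum_(w <- ws) g w * prodf (phi w) z.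
  move=> zs; rewrite (bigD1_seq z) ?undup_uniq ?mem_undup//= prodfE eqxx mulr1.
  by rewrite big1 ?addr0// => w wz; rewrite prodfE eq_sym (negbTE wz) mulr0.
rewrite sE (eq_big_seq (fun p => \sum_(w <- ws) g w * (p.1 * prodf (phi w) p.2))).
  rewrite exchange_big big1//= => w _; rewrite -mulr_sumr.
  by have := L0 (phi w); rewrite sE => ->; rewrite mulr0.
move=> p ps; rewrite gE; first by rewrite mulr_sumr; apply: eq_bigr => w _; rewrite mulrCA.
by apply/mapP; exists p.
Qed.

Lemma prod_ext_eq m (L1 L2 : (m.-tuple R -> R) -> R) :
  fin_comb L1 -> fin_comb L2 ->
  (forall phi, L1 (prodf phi) = L2 (prodf phi)) -> forall g, L1 g = L2 g.
Proof.
move=> h1 h2 h g; apply/eqP; rewrite -subr_eq0 -mulN1r; apply/eqP.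
apply: (@prod_ext _ (fun g => L1 g + -1 * L2 g)).
  by apply: fin_combD h1 (fin_combZ _ h2).
by move=> phi; rewrite h mulN1r subrr.
Qed.

Lemma fin_comb_quasi_volume m (u v : m.-tuple R) :
  fin_comb (fun g => quasi_volume g u v).
Proof. by apply: fin_comb_sum => D; exact: fin_comb_eval. Qed.

Lemma fin_comb_quasi_volume_comp m n (f : n.-tuple R -> m.-tuple R)
    (u v : n.-tuple R) :
  fin_comb (fun g => quasi_volume (fun y => g (f y)) u v).
Proof. by apply: fin_comb_sum => D; exact: fin_comb_eval. Qed.

(** Expanding the product of differences, [D] is the set of coordinates in which the term at the
    lower end, with its minus sign, is chosen. *)
Lemma quasi_volume_prod m (phi : 'I_m -> R -> R) (u v : m.-tuple R) :
  quasi_volume (prodf phi) u v =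
  \prod_(j < m) (phi j (tnth v j) - phi j (tnth u j)).
Proof.
rewrite (eq_bigr (fun j => - phi j (tnth u j) + phi j (tnth v j))); last first.
  by move=> j _; rewrite addrC.
rewrite bigA_distr; apply: eq_bigr => D _; rewrite /prodf -prodr_const.
rewrite big_mkcond/= -big_split/=; apply: eq_bigr => j _.
rewrite tnth_mktuple; case: (j \in D); first by rewrite mulN1r mul1r addrC subrK.
by rewrite mul0r mul1r addr0.
Qed.

Lemma quasi_volumeZ m c (g : m.-tuple R -> R) (u v : m.-tuple R) :
  quasi_volume (fun x => c * g x) u v = c * quasi_volume g u v.
Proof. by rewrite /quasi_volume mulr_sumr; apply: eq_bigr => D _; rewrite mulrCA. Qed.

Lemma eq_quasi_volume m (g h : m.-tuple R -> R) (u v : m.-tuple R) :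
  (forall x, (forall j, tnth x j = tnth u j \/ tnth x j = tnth v j) -> g x = h x) ->
  quasi_volume g u v = quasi_volume h u v.
Proof.
move=> gh; apply: eq_bigr => D _; rewrite gh// => j; rewrite tnth_mktuple.
by case: (j \in D); [left; rewrite mul1r addrC subrK|right; rewrite mul0r addr0].
Qed.

Lemma tnth_face_val m (B : {set 'I_m}) (y : #|B|.-tuple R) i :
  tnth (@face R m B y) (enum_val i) = tnth y i.
Proof.
rewrite tnth_mktuple enum_valP (tnth_nth 0); congr nth.
by rewrite (enum_val_nth (enum_val i)) index_uniq ?enum_uniq// -cardE.
Qed.

Lemma tnth_face_out m (B : {set 'I_m}) (y : #|B|.-tuple R) j :
  j \notin B -> tnth (@face R m B y) j = 0.
Proof. by move=> jB; rewrite tnth_mktuple (negbTE jB). Qed.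

Lemma tnth_sub_tuple m (B : {set 'I_m}) (x : m.-tuple R) i :
  tnth (sub_tuple B x) i = tnth x (enum_val i).
Proof. by rewrite tnth_mktuple. Qed.

Lemma prodf_face m (B : {set 'I_m}) phi (y : #|B|.-tuple R) :
  prodf phi (face y) =
  (\prod_(j | j \notin B) phi j 0) * prodf (fun i => phi (enum_val i)) y.
Proof.
rewrite /prodf (bigID (mem B))/= mulrC; congr (_ * _).
  by apply: eq_bigr => j jB; rewrite tnth_face_out.
by rewrite big_enum_val; apply: eq_bigr => i _; rewrite tnth_face_val.
Qed.

(** On products this is the expansion of the product of [(phi j x_j - phi j 0) + phi j 0]. It splits
    [g] into one distribution function per face, matching the terms of [VHK0]; the empty face
    contributes the value at the origin. *)
Lemma quasi_volume_face_sum m (g : m.-tuple R -> R) (x : m.-tuple R) :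
  g x = \sum_(B : {set 'I_m})
    quasi_volume (fun y => g (@face R m B y)) (Defs.tuple0 #|B|) (sub_tuple B x).
Proof.
move: g; apply: prod_ext_eq; first exact: fin_comb_eval.
  have := @fin_comb_sum m _ (index_enum {set 'I_m}) xpredT (fun=> 1)
    (fun B g => quasi_volume (fun y => g (@face R m B y))
      (Defs.tuple0 #|B|) (sub_tuple B x)) (fun B => fin_comb_quasi_volume_comp _ _ _).
  by move=> [s h]; exists s => g; rewrite -h; apply: eq_bigr => B _; rewrite mul1r.
move=> phi /=; rewrite [RHS](_ : _ = \sum_(B : {set 'I_m})
    (\prod_(j in B) (phi j (tnth x j) - phi j 0)) * \prod_(j | j \notin B) phi j 0); last first.
  apply: eq_bigr => B _ /=; rewrite (@eq_quasi_volume _ _ (fun y =>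
    (\prod_(j | j \notin B) phi j 0) * prodf (fun i => phi (enum_val i)) y)); last first.
    by move=> y _; rewrite prodf_face.
  rewrite quasi_volumeZ quasi_volume_prod mulrC [in RHS]big_enum_val; congr (_ * _).
  by apply: eq_bigr => i _; rewrite tnth_sub_tuple tnth_mktuple.
rewrite /prodf (eq_bigr (fun j => (phi j (tnth x j) - phi j 0) + phi j 0)); last first.
  by move=> j _; rewrite subrK.
rewrite bigA_distr/=; apply: eq_bigr => B _; rewrite (bigID (mem B))/=.
by congr (_ * _); apply: eq_bigr => j; [move=> ->|move=> /negbTE ->].
Qed.

End finite_combinations.

(** * Dyadic cells *)

Section binary_words.
Variable m : nat.
Local Notation letter := {ffun 'I_m -> bool}.

(* The most recent letter of a word is its head. *)
Fixpoint wnum (w : seq letter) (i : 'I_m) : nat :=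
  if w is c :: w' then ((wnum w' i).*2 + c i)%N else 0%N.

Lemma wnum_lt w i : (wnum w i < 2 ^ size w)%N.
Proof.
by elim: w => [|c w IH]//=; rewrite expnS; case: (c i) => /=; lia.
Qed.

Lemma wnum_inj w w' : size w = size w' -> wnum w =1 wnum w' -> w = w'.
Proof.
elim: w w' => [|c w IH] [|c' w']//= [sw] e.
have odd_eq (b b' : bool) n n' : (n.*2 + b = n'.*2 + b')%N -> b = b' /\ n = n'.
  by case: b b' => [] [] => nn'; split=> //; lia.
by congr cons; [apply/ffunP => i; case: (odd_eq _ _ _ _ (e i))|
  apply: IH => // i; case: (odd_eq _ _ _ _ (e i))].
Qed.

Section sums.
Context {R : realType}.

Definition wsum k (F : seq letter -> R) : R := \sum_(w : k.-tuple letter) F w.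

Lemma wsum0 F : wsum 0 F = F [::].
Proof.
by rewrite /wsum (big_pred1 [tuple])// => w; apply/esym/eqP/val_inj; rewrite [RHS]/=; case: w => -[].
Qed.

Lemma wsumS k F : wsum k.+1 F = wsum k (fun w => \sum_c F (c :: w)).
Proof.
rewrite /wsum (reindex (fun p : k.-tuple letter * letter => [tuple of p.2 :: p.1])).
  by rewrite pair_big.
exists (fun w : k.+1.-tuple letter => ([tuple of behead w], thead w)) => [[w c]|w] _ /=.
  by congr pair; apply/val_inj.
by rewrite [RHS]tuple_eta.
Qed.

Lemma eq_wsum k F G : (forall w, size w = k -> F w = G w) -> wsum k F = wsum k G.
Proof. by move=> FG; apply: eq_bigr => w _; rewrite FG ?size_tuple. Qed.

(** A word of length [k] amounts to [k] binary digits for each coordinate independently, so its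
    numbers run through the whole grid and the sum factors. *)
Lemma wsum_prod k (F : 'I_m -> nat -> R) :
  wsum k (fun w => \prod_i F i (wnum w i)) = \prod_i \sum_(j < 2 ^ k) F i j.
Proof.
elim: k F => [|k IH] F.
  by rewrite wsum0; apply: eq_bigr => i _; rewrite expn0 big_ord1.
rewrite wsumS; pose F' i j := \sum_(b : bool) F i (j.*2 + b)%N.
transitivity (wsum k (fun w => \prod_i F' i (wnum w i))).
  by apply: eq_wsum => w _; rewrite /F' bigA_distr_bigA.
rewrite IH; apply: eq_bigr => i _; rewrite /F' expnS mul2n.
under eq_bigr => j _ do rewrite big_bool/= addn1 addn0.
elim: (2 ^ k)%N => [|n IHn]; first by rewrite !big_ord0.
by rewrite doubleS !big_ord_recr/= IHn -addrA; congr (_ + _); rewrite addrC.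
Qed.

End sums.
End binary_words.

Section dyadic_cells.
Context {R : realType} {m : nat}.
Local Notation letter := {ffun 'I_m -> bool}.
Implicit Types (h : m.-tuple R -> R) (w : seq letter).

Definition dyadic k (n : nat) : R := n%:R / 2 ^+ k.

Definition cell_lo w : m.-tuple R := [tuple dyadic (size w) (wnum w i) | i < m].
Definition cell_hi w : m.-tuple R := [tuple dyadic (size w) (wnum w i).+1 | i < m].
Definition cell_volume h w := quasi_volume h (cell_lo w) (cell_hi w).

Lemma dyadicS k n : dyadic k.+1 n.*2 = dyadic k n.
Proof.
rewrite /dyadic exprS -muln2 natrM; have : 2 ^+ k != 0 :> R by rewrite expf_neq0.
by move=> k0; field.
Qed.

Lemma fin_comb_cell_volume w : fin_comb (cell_volume^~ w).
Proof. exact: fin_comb_quasi_volume. Qed.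

Lemma cell_volume_prod phi w : cell_volume (prodf phi) w =
  \prod_i (phi i (dyadic (size w) (wnum w i).+1) - phi i (dyadic (size w) (wnum w i))).
Proof.
by rewrite /cell_volume quasi_volume_prod; apply: eq_bigr => i _; rewrite !tnth_mktuple.
Qed.

(** On products, the two halves of an edge telescope at the midpoint in each coordinate. *)
Lemma cell_volume_split h w : cell_volume h w = \sum_c cell_volume h (c :: w).
Proof.
move: h; apply: prod_ext_eq; first exact: fin_comb_cell_volume.
  have [s hs] := @fin_comb_sum _ m _ (index_enum letter) xpredT (fun=> 1)
    (fun c h => cell_volume h (c :: w)) (fun c => fin_comb_cell_volume _).
  by exists s => g; rewrite -hs; apply: eq_bigr => c _; rewrite mul1r.
move=> phi; rewrite cell_volume_prod.
under [RHS]eq_bigr => c _ do rewrite cell_volume_prod/=.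
rewrite -(bigA_distr_bigA (fun i (b : bool) =>
  phi i (dyadic (size w).+1 ((wnum w i).*2 + b).+1) -
  phi i (dyadic (size w).+1 ((wnum w i).*2 + b)))).
apply: eq_bigr => i _; rewrite big_bool/= addn1 addn0 -doubleS !dyadicS addrA.
by congr (_ - _); rewrite subrK.
Qed.

(** The selected cells tile the box; on products the sum telescopes in each coordinate, the lower
    end being [0]. *)
Lemma cell_volume_grid h k (N : 'I_m -> nat) : (forall i, N i <= 2 ^ k)%N ->
  wsum k (fun w => [forall i, wnum w i < N i]%N%:R * cell_volume h w) =
  quasi_volume h (Defs.tuple0 m) [tuple dyadic k (N i) | i < m].
Proof.
move=> Nk; move: h; apply: prod_ext_eq.
- have [s hs] := @fin_comb_sum _ m _ (index_enum (k.-tuple letter)) xpredT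
    (fun w : k.-tuple letter => [forall i, wnum w i < N i]%N%:R)
    (fun (w : k.-tuple letter) h => cell_volume h w)
    (fun w : k.-tuple letter => fin_comb_cell_volume w).
  by exists s => g; rewrite -hs.
- exact: fin_comb_quasi_volume.
move=> phi; rewrite quasi_volume_prod.
pose F i j := (j < N i)%N%:R * (phi i (dyadic k j.+1) - phi i (dyadic k j)).
transitivity (wsum k (fun w : seq letter => \prod_i F i (wnum w i))).
  apply: eq_wsum => w wk; rewrite cell_volume_prod wk /F big_split/=; congr (_ * _).
  have [/forallP wN|/forallPn[i wN]] := boolP [forall i, wnum w i < N i]%N.
    by rewrite big1// => i _; rewrite wN.
  by rewrite (bigD1 i)//= (negbTE wN) mul0r.
rewrite wsum_prod; apply: eq_bigr => i _; rewrite !tnth_mktuple.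
rewrite -(big_mkord xpredT (F i)) (big_cat_nat _ (n := N i))//=.
rewrite [X in _ + X]big_nat_cond [X in _ + X]big1 ?addr0; last first.
  by move=> j; rewrite andbT => /andP[Nj _]; rewrite /F ltnNge Nj mul0r.
rewrite (eq_big_nat _ _ (F2 := fun j => phi i (dyadic k j.+1) - phi i (dyadic k j))).
  by rewrite telescope_sumr// /dyadic mul0r.
by move=> j /andP[_ jN]; rewrite /F jN mul1r.
Qed.

Definition dyadic_split k (i : 'I_m) : seq R := mkseq (fun j => dyadic k j.+1) (2 ^ k).

Lemma nth_dyadic_split k i j : (j <= 2 ^ k)%N ->
  nth 0 (0 :: dyadic_split k i) j = dyadic k j.
Proof.
by case: j => [|j] jk /=; [rewrite /dyadic mul0r|rewrite nth_mkseq].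
Qed.

Lemma is_split_dyadic k : is_split (dyadic_split k).
Proof.
move=> i; rewrite /itv_partition; split.
  apply/(pathP 0) => j; rewrite size_mkseq => jk.
  rewrite nth_dyadic_split 1?ltnW// nth_mkseq// /dyadic ltr_pM2r ?invr_gt0 ?exprn_gt0//.
  by rewrite ltr_nat.
have : nth 0 (0 :: dyadic_split k i) (2 ^ k) = 1.
  by rewrite nth_dyadic_split// /dyadic natrX divff// expf_neq0.
by rewrite (last_nth 0) size_mkseq => ->.
Qed.

(** The dyadic grid is an admissible split, and distinct words give distinct cells of it; the sum
    over words is thus part of a sum bounded by the supremum. *)
Lemma wsum_cell_volume_le h k :
  ((wsum k (fun w => `|cell_volume h w|))%:E <= vitali h)%E.
Proof.
apply: (@le_trans _ _ (split_variation h (dyadic_split k))%:E); last first.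
  by apply: ereal_sup_ubound; exists (dyadic_split k) => //; exact: is_split_dyadic.
rewrite lee_fin /wsum /split_variation.
have wlt (w : k.-tuple letter) i : (wnum w i < size (dyadic_split k i))%N.
  by rewrite size_mkseq -[k in (2 ^ k)%N](size_tuple w) wnum_lt.
pose L (w : k.-tuple letter) : {dffun forall i : 'I_m, 'I_(size (dyadic_split k i))} :=
  [ffun i => Ordinal (wlt w i)].
have L_inj : injective L.
  move=> w w' LL; apply/val_inj/wnum_inj; first by rewrite !size_tuple.
  by move=> i; have := congr1 (fun f : {dffun forall i : 'I_m, 'I_(size (dyadic_split k i))} =>
    val (f i)) LL; rewrite !ffunE.
pose G (l : {dffun forall i : 'I_m, 'I_(size (dyadic_split k i))}) : R :=
  `| quasi_volume h [tuple nth 0 (0 :: dyadic_split k i) (l i) | i < m]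
                    [tuple nth 0 (0 :: dyadic_split k i) (l i).+1 | i < m] |.
rewrite -[leRHS]/(\sum_l G l).
rewrite (eq_bigr (fun w : k.-tuple letter => G (L w))); last first.
  move=> w _; rewrite /G; congr `|_|; rewrite /cell_volume.
  have kE := size_tuple w.
  congr quasi_volume; apply: eq_from_tnth => i; rewrite !tnth_mktuple ffunE/= kE.
    by rewrite nth_dyadic_split// -[k in (2 ^ k)%N]kE ltnW ?wnum_lt.
  by rewrite nth_mkseq// -[k in (2 ^ k)%N]kE wnum_lt.
rewrite -(big_imset _ (in2W L_inj))/=.
rewrite [leRHS](bigID (mem (L @: xpredT)))/= lerDl sumr_ge0// => l _.
exact: normr_ge0.
Qed.

(* [mu w] is the limit of the sums of [`|cell_volume h|] over the descendants of
   [w] at a given depth; they increase with the depth. *)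
Lemma variation_tree h (V : R) : (vitali h <= V%:E)%E ->
  exists mu : seq letter -> R,
    [/\ forall w, `|cell_volume h w| <= mu w,
        forall w, mu w = \sum_c mu (c :: w) & mu [::] <= V].
Proof.
move=> hV.
pose v := fix v j w := if j is j'.+1 then \sum_c v j' (c :: w) else `|cell_volume h w|.
have v_ge0 j w : 0 <= v j w by elim: j w => //= j IH w; exact: sumr_ge0.
have vnd w : nondecreasing_seq (v^~ w).
  apply/nondecreasing_seqP => j; elim: j w => [|j IH] w /=.
    by rewrite cell_volume_split; exact: ler_norm_sum.
  by apply: ler_sum => c _; exact: IH.
have vnil j : v j [::] <= V.
  rewrite -lee_fin; apply: le_trans hV; apply: le_trans (wsum_cell_volume_le h j).
  have -> : v j [::] = wsum 0 (v j) by rewrite wsum0.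
  suff H k : wsum k (v j) = wsum (j + k) (v 0%N) by rewrite H addn0.
  by elim: j k => // j IH k; rewrite addSnnS -IH wsumS.
have vV w j : v j w <= V.
  (* The sum at a child is one summand of the sum at its parent taken one step deeper, so the bound
     at the root passes down the tree. *)
  elim: w j => // c w IH j; apply: le_trans (IH j.+1); rewrite /= (bigD1 c)//=.
  by rewrite lerDl sumr_ge0.
have vcvg w : cvgn (v^~ w).
  apply: nondecreasing_is_cvgn => //; exists V => _ [j _ <-]; exact: vV.
exists (fun w => limn (v^~ w)); split.
- by move=> w; exact: (nondecreasing_cvgn_le (vnd w) (vcvg w) 0%N).
- move=> w; apply/cvg_lim => //; rewrite -cvg_shiftS/=.
  by apply: (@cvg_big R^o) => [|c _]; [exact: add_continuous|exact: vcvg].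
- by apply: limr_le => //; near=> j; exact: vnil.
Unshelve. all: by end_near. Qed.

End dyadic_cells.

Lemma measure_big_setU d (T : measurableType d) (R : realType)
    (mu : {measure set T -> \bar R}) (I : finType) (P : pred I) (F : I -> set T) :
  (forall i, measurable (F i)) ->
  (forall i j, P i -> P j -> i != j -> F i `&` F j = set0) ->
  mu (\big[setU/set0]_(i | P i) F i) = (\sum_(i | P i) mu (F i))%E.
Proof.
move=> mF tF; rewrite -!(big_filter _ P).
set s := [seq i <- _ | _].
have : all P s by rewrite filter_all.
have : uniq s by rewrite filter_uniq ?index_enum_uniq.
elim: s => [|i s IH]; first by rewrite !big_nil measure0.
move=> /= /andP[is_ us] /andP[Pi Ps]; rewrite !big_cons measureU//.
- by congr (_ + _)%E; exact: IH.
- exact: bigsetU_measurable.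
rewrite big_distrr/= big_seq big1// => j js; apply: tF => //; first exact: (allP Ps).
by apply: contraNneq is_ => ->.
Qed.

(** * Measures from trees of weights *)

(* A word [w] is represented by an interval of length [M w]; the intervals of the
   words [c :: w] follow one another inside that of [w], in the order of the
   letters [c]. *)
Section tree_measure.
Context {R : realType} (C : finType) (c0 : C) (M : seq C -> R).
Hypothesis M_ge0 : forall w, 0 <= M w.
Hypothesis M_split : forall w, M w = \sum_c M (c :: w).

Let before w i := \sum_(c | (enum_rank c < i)%N) M (c :: w).

Let beforeS w c : before w (enum_rank c).+1 = before w (enum_rank c) + M (c :: w).
Proof.
rewrite /before (bigD1 c)//= addrC; congr (_ + _); apply: eq_bigl => c'.
by rewrite ltnS ltn_neqAle andbC -(inj_eq enum_rank_inj c' c) -val_eqE.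
Qed.

Let before_le w i j : (i <= j)%N -> before w i <= before w j.
Proof.
move=> ij; rewrite [leRHS](bigID (fun c => enum_rank c < i)%N)/=.
rewrite (eq_bigl (fun c => enum_rank c < i)%N); first by rewrite lerDl sumr_ge0.
by move=> c; rewrite andbC; case: ltnP => //= /leq_trans ->.
Qed.

Let before0 w : before w 0%N = 0. Proof. by rewrite /before big_pred0. Qed.

Let before_card w : before w #|C| = M w.
Proof. by rewrite M_split; apply: eq_bigl => c; rewrite ltn_ord. Qed.

Fixpoint node_start w : R :=
  if w is c :: w' then node_start w' + before w' (enum_rank c) else 0.

(** Being open on the left and closed on the right, the intervals of the children tile that of the
    parent exactly, and a word of weight 0 gets the empty interval. *)
Definition node w : set R := `]node_start w, node_start w + M w]%classic.

Let mnode w : measurable (node w : set (measurableTypeR R)).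
Proof. exact: measurable_itv. Qed.

Let nodeE c w : node (c :: w) =
  `]node_start w + before w (enum_rank c), node_start w + before w (enum_rank c).+1]%classic.
Proof. by rewrite /node/= beforeS addrA. Qed.

Let node_sub c w : node (c :: w) `<=` node w.
Proof.
rewrite nodeE => u; rewrite /node/= !in_itv/= => /andP[h1 h2]; apply/andP; split.
  by apply: le_lt_trans h1; rewrite lerDl -(before0 w) before_le.
apply: le_trans h2 _; rewrite lerD2l -before_card before_le//.
Qed.

Let node_letter w u : node w u -> exists c, node (c :: w) u.
Proof.
rewrite /node/= in_itv/= => /andP[h1 h2].
suff H n : (n <= #|C|)%N -> u <= node_start w + before w n ->
    exists2 i, (i < n)%N & node_start w + before w i < u <= node_start w + before w i.+1.
  have [|i iC ui] := H #|C| (leqnn _); first by rewrite before_card.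
  exists (enum_val (Ordinal iC)); rewrite in_itv/= -addrA -beforeS.
  by rewrite enum_valK.
elim: n => [|n IH] nC un.
  by move: h1; rewrite ltNge; move: un; rewrite before0 addr0 => ->.
have [un'|un'] := leP u (node_start w + before w n).
  by have [i ni ui] := IH (ltnW nC) un'; exists i => //; rewrite ltnS ltnW.
by exists n => //; rewrite un' un.
Qed.

Let node_disj c c' w u : node (c :: w) u -> node (c' :: w) u -> c = c'.
Proof.
wlog cc' : c c' / (enum_rank c <= enum_rank c')%N.
  by move=> H; have [/H|/ltnW/H] := leqP (enum_rank c) (enum_rank c'); [|move=> + ? ?; move=> ->].
rewrite !nodeE/= !in_itv/= => /andP[_ h1] /andP[h2 _].
apply/eqP; apply/negPn/negP => ncc'.
have /(before_le w) : (enum_rank c < enum_rank c')%N.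
  by rewrite ltn_neqAle cc' andbT val_eqE (inj_eq enum_rank_inj).
by rewrite -(lerD2l (node_start w)) leNgt (lt_le_trans h2 h1).
Qed.

Let pick_word u := fix pick_word k : seq C := if k is k'.+1
  then odflt c0 [pick c | u \in node (c :: pick_word k')] :: pick_word k' else [::].

(** Outside the root interval the word is a constant default, so that its length is always [k]. The
    measure in [tree_measure] is Lebesgue measure restricted to the root interval, where the default
    is not met. *)
Definition tree_word k (u : R) : seq C :=
  if u \in node [::] then pick_word u k else nseq k c0.

Let size_tree_word k u : size (tree_word k u) = k.
Proof.
rewrite /tree_word; case: ifP => _; last by rewrite size_nseq.
by elim: k => //= k ->.
Qed.

Let tree_wordS k u : exists c, tree_word k.+1 u = c :: tree_word k u.
Proof. by rewrite /tree_word; case: ifP => _; eexists; reflexivity. Qed.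

Let tree_word_node k u : node [::] u -> node (tree_word k u) u.
Proof.
move=> u0; rewrite /tree_word mem_set//; elim: k => //= k IH.
case: pickP => [c /set_mem//|/= h].
by have [c cu] := node_letter IH; have := h c; rewrite mem_set.
Qed.

Let tree_word_uniq w u : node w u -> tree_word (size w) u = w.
Proof.
elim: w => [|c w IH] wu; first by apply: size0nil; rewrite size_tree_word.
have /IH wE := node_sub wu.
have [c' E] := tree_wordS (size w) u.
have u0 : node [::] u by elim: (c :: w) wu => // ? ? IH' /node_sub.
have := tree_word_node (size w).+1 u0; rewrite /= E wE => /node_disj h.
by rewrite (h c).
Qed.

Let node_nil_lty : (@lebesgue_measure R (node [::]) < +oo)%E.
Proof. by rewrite lebesgue_measure_itv/=; case: ifP; rewrite ?ltry. Qed.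

Let tree_word_preimage k (S : seq C -> bool) : [set u | S (tree_word k u)] =
  \big[setU/set0]_(w : k.-tuple C | S w) node w `|`
  (if S (nseq k c0) then ~` node [::] else set0).
Proof.
apply/seteqP; split => u /=.
  have [u0 Su|u0 Su] := pselect (node [::] u); last first.
    by right; move: Su; rewrite /tree_word memNset// => ->.
  left; pose w : k.-tuple C := Tuple (introT eqP (size_tree_word k u)).
  by rewrite (bigD1 w)//=; left; exact: tree_word_node.
have node_nil w : node w u -> node [::] u by elim: w => // ? ? IH' /node_sub.
case=> [|].
  elim/big_rec: _ => //= w A Sw IH [wu|//].
  by rewrite -[k](size_tuple w) tree_word_uniq.
by case: ifP => // Sn u0; rewrite /tree_word memNset.
Qed.

(** One space carries random words of all lengths, each extending the previous one, with [M] as the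
    law at every length: the points with word [w] in the root interval form an interval of length
    [M w]. Arbitrary predicates [S] on words are allowed so that any function of a word is
    measurable. *)
Lemma tree_measure :
  exists (Q : {finite_measure set (measurableTypeR R) -> \bar R})
    (word : nat -> measurableTypeR R -> seq C),
  [/\ forall k (S : seq C -> bool), measurable [set u | S (word k u)],
      forall k (S : seq C -> bool), Q [set u | S (word k u)] =
        (\sum_(w : k.-tuple C) (S w)%:R * M w)%:E,
      forall u, word 0%N u = [::] &
      forall k u, exists c, word k.+1 u = c :: word k u].
Proof.
have mS k (S : seq C -> bool) :
    measurable ([set u | S (tree_word k u)] : set (measurableTypeR R)).
  rewrite tree_word_preimage; apply: measurableU.
    by apply: bigsetU_measurable => w _; exact: mnode.
  by case: ifP => _ //; apply: measurableC; exact: mnode.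
exists (mfrestr (mnode [::]) node_nil_lty), tree_word; split=> //; last first.
  by move=> u; exact/size0nil/size_tree_word.
move=> k S; rewrite tree_word_preimage.
rewrite -[LHS]/(lebesgue_measure ((_ `|` _) `&` _)) setIUl.
rewrite [X in _ `|` X](_ : _ = set0) ?setU0; last first.
  by case: ifP => _; rewrite ?setICl ?set0I.
rewrite setIidl; last first.
  elim/big_rec: _ => // w A _ IH u [|/IH//].
  by elim: (tval w) => // ? ? IH' /node_sub.
rewrite measure_big_setU//=.
- rewrite -sumEFin big_mkcond/=; apply: eq_bigr => w _.
  case: ifP => _; last by rewrite mul0r.
  rewrite mul1r lebesgue_measure_itv/= lte_fin ltrDl.
  case: ltP => [_|Mw]; first by rewrite -EFinB addrAC subrr add0r.
  by congr EFin; apply/eqP; rewrite eq_le M_ge0.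
- move=> w w' _ _ ww'; rewrite -subset0 => u [wu w'u]; move/negP: ww'; apply.
  apply/eqP/val_inj => /=; rewrite -(tree_word_uniq wu) -(tree_word_uniq w'u).
  by rewrite !size_tuple.
Qed.

End tree_measure.

(** * Finite measures and limits in one level at a time *)

Section measure_preliminaries.
Context {R : realType}.

Lemma measurable_forall_ord d (T : measurableType d) m (F : 'I_m -> set T) :
  (forall i, measurable (F i)) -> measurable [set t | forall i, F i t].
Proof.
move=> mF; rewrite [X in measurable X](_ : _ = \bigcap_(i in [set: 'I_m]) F i).
  by apply: fin_bigcap_measurable => //; exact: finite_finset.
by apply/seteqP; split => t h i; [move=> _|]; exact: h.
Qed.

Lemma finite_pushforward_ex d d' (T : measurableType d) (T' : measurableType d')
    (mu : {finite_measure set T -> \bar R}) (f : T -> T') :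
  measurable_fun setT f ->
  exists nu : {finite_measure set T' -> \bar R}, forall A, nu A = mu (f @^-1` A).
Proof.
move=> mf; pose pf : {measure set T' -> \bar R} :=
  measure_function_pushforward__canonical__measure_function_Measure mu mf.
have fin : fin_num_fun pf.
  move=> A mA; apply: fin_num_measure.
  by rewrite -[X in measurable X]setTI; exact: (mf measurableT A mA).
pose pf_fin := Measure_isFinite.Build _ _ _ (Measure.sort pf) fin.
pose pff : {finite_measure set T' -> \bar R} :=
  HB.pack (Measure.sort pf) (Measure.class pf) pf_fin.
by exists pff.
Qed.

Lemma finite_mrestr_ex d (T : measurableType d) (mu : {finite_measure set T -> \bar R})
    (D : set T) : measurable D ->
  exists nu : {finite_measure set T -> \bar R}, forall A, nu A = mu (A `&` D).
Proof.
move=> mD; have Doo : (mu D < +oo)%E by rewrite ltey_eq fin_num_measure.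
by exists (mfrestr mD Doo).
Qed.

Lemma finite_measure_sum_ex d (T : measurableType d) (I : Type) (r : seq I) (P : pred I)
    (mu : I -> {finite_measure set T -> \bar R}) :
  exists nu : {finite_measure set T -> \bar R},
    forall A, nu A = (\sum_(i <- r | P i) mu i A)%E.
Proof.
elim: r => [|i r [nu nuE]].
  by exists mzero => A; rewrite big_nil.
case Pi : (P i); last by exists nu => A; rewrite big_cons Pi.
pose nu' : {measure set T -> \bar R} := measure_add (mu i) nu.
have fin : fin_num_fun nu'.
  move=> A mA; have -> : nu' A = (mu i A + nu A)%E by exact: measure_addE.
  by rewrite fin_numD !fin_num_measure.
pose nu'_fin := Measure_isFinite.Build _ _ _ (Measure.sort nu') fin.
pose nuf : {finite_measure set T -> \bar R} :=
  HB.pack (Measure.sort nu') (Measure.class nu') nu'_fin.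
by exists nuf => A; rewrite big_cons Pi -nuE; exact: measure_addE.
Qed.

Lemma finite_charge_ex d (T : measurableType d) (P N : {finite_measure set T -> \bar R}) :
  exists nu : {charge set T -> \bar R}, forall A, nu A = (P A - N A)%E.
Proof.
by exists (cadd (charge_of_finite_measure P) (copp (charge_of_finite_measure N))).
Qed.

Section boxes.
Context d (T : measurableType d) (Q : {finite_measure set T -> \bar R}) (m : nat)
  (G : 'I_m -> option nat -> set T).
Hypothesis mG : forall i k, measurable (G i k).

Definition set_level (kappa : 'I_m -> option nat) i k : 'I_m -> option nat :=
  fun j => if j == i then k else kappa j.

(** Coordinate [i] is constrained at its own level [kappa i], and [None] stands for the limit
    constraint. Sending a single level to infinity is then continuity of the measure from above or
    from below. *)
Definition box (kappa : 'I_m -> option nat) : set T :=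
  [set t | forall i, G i (kappa i) t].

Lemma measurable_box kappa : measurable (box kappa).
Proof. exact: measurable_forall_ord. Qed.

Lemma set_level_id kappa i : set_level kappa i (kappa i) = kappa.
Proof. by apply/funext => j; rewrite /set_level; case: eqVneq => // ->. Qed.

Lemma boxE kappa i : box kappa = G i (kappa i) `&` [set t | forall j, j != i -> G j (kappa j) t].
Proof.
apply/seteqP; split => t /=; first by move=> h; split => // j _; exact: h.
by move=> [hi h] j; have [->|/h] := eqVneq j i.
Qed.

Lemma box_set_level kappa i k : box (set_level kappa i k) =
  G i k `&` [set t | forall j, j != i -> G j (kappa j) t].
Proof.
rewrite (boxE _ i) /set_level eqxx; congr (_ `&` _); apply/seteqP.
by split => t h j ji; have := h j ji; rewrite (negbTE ji).
Qed.

Lemma box_cvg_decreasing i : nonincreasing_seq (fun k => G i (Some k)) ->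
  \bigcap_k G i (Some k) = G i None -> forall kappa, kappa i = None ->
  fine (Q (box (set_level kappa i (Some k)))) @[k --> \oo] --> fine (Q (box kappa)).
Proof.
move=> niG GN kappa ki.
set F := fun k => box (set_level kappa i (Some k)).
have FE : \bigcap_k F k = box kappa.
  rewrite -(set_level_id kappa i) ki box_set_level -GN.
  apply/seteqP; split => t.
    move=> h; split; last by have := h 0%N I; rewrite /F box_set_level => -[].
    by move=> k _; have := h k I; rewrite /F box_set_level => -[].
  by move=> [h1 h2] k _; rewrite /F box_set_level; split => //; exact: h1.
apply: fine_cvg; rewrite fineK; last by apply: fin_num_measure; exact: measurable_box.
rewrite -FE; apply: nonincreasing_cvg_mu.
- by rewrite -ge0_fin_numE//; apply: fin_num_measure; exact: measurable_box.
- by move=> k; exact: measurable_box.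
- by rewrite FE; exact: measurable_box.
- move=> k l kl; rewrite /F !box_set_level subsetEset; apply: setSI.
  by rewrite -subsetEset; exact: niG.
Qed.

Lemma box_cvg_increasing i : nondecreasing_seq (fun k => G i (Some k)) ->
  \bigcup_k G i (Some k) = G i None -> forall kappa, kappa i = None ->
  fine (Q (box (set_level kappa i (Some k)))) @[k --> \oo] --> fine (Q (box kappa)).
Proof.
move=> niG GN kappa ki.
set F := fun k => box (set_level kappa i (Some k)).
have FE : \bigcup_k F k = box kappa.
  rewrite -(set_level_id kappa i) ki box_set_level -GN setI_bigcupl.
  by apply: eq_bigcupr => k _; rewrite /F box_set_level.
apply: fine_cvg; rewrite fineK; last by apply: fin_num_measure; exact: measurable_box.
rewrite -FE; apply: nondecreasing_cvg_mu.
- by move=> k; exact: measurable_box.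
- by rewrite FE; exact: measurable_box.
- move=> k l kl; rewrite /F !box_set_level subsetEset; apply: setSI.
  by rewrite -subsetEset; exact: niG.
Qed.

End boxes.

(* Two functions of a multi-index of levels in [nat] or at infinity ([None])
   agree as soon as they agree at finite levels and both pass to the limit in
   one level at a time. *)
Lemma iterated_limit m (a b : ('I_m -> option nat) -> R) :
  (forall kappa : 'I_m -> nat, a (Some \o kappa) = b (Some \o kappa)) ->
  (forall kappa i, kappa i = None ->
    a (set_level kappa i (Some k)) @[k --> \oo] --> a kappa) ->
  (forall kappa i, kappa i = None ->
    b (set_level kappa i (Some k)) @[k --> \oo] --> b kappa) ->
  a = b.
Proof.
move=> ab ca cb; apply/funext => kappa.
(* Induction on a bound [J] for the indices whose level may be infinite: making the level of index
   [J] finite brings back the previous case, and both sides pass to the limit in that level. *)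
suff H J : (J <= m)%N ->
    forall kappa : 'I_m -> option nat, (forall i, kappa i = None -> (i < J)%N) ->
    a kappa = b kappa.
  exact: (H m (leqnn m) kappa (fun i _ => ltn_ord i)).
elim: J => [|J IH] Jm {}kappa kJ.
  have -> : kappa = Some \o (fun i => odflt 0%N (kappa i)).
    by apply/funext => i /=; case: (kappa i) (kJ i) => // /(_ erefl).
  exact: ab.
have [kN|kS] := eqVneq (kappa (Ordinal Jm)) None; last first.
  apply: IH (ltnW Jm) _ _ => i ki; have := kJ i ki; rewrite ltnS leq_eqVlt => /orP[/eqP iJ|//].
  by move: kS; rewrite -ki (_ : i = Ordinal Jm) ?eqxx//; exact/val_inj.
apply: (cvg_unique _ (ca _ _ kN)) => //; apply: cvg_trans (cb _ _ kN).
apply: near_eq_cvg; apply: nearW => k; apply/esym/(IH (ltnW Jm)) => i.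
rewrite /set_level; case: eqVneq => // iJ /kJ; rewrite ltnS leq_eqVlt.
by rewrite -[J]/(val (Ordinal Jm)) val_eqE (negbTE iJ).
Qed.

End measure_preliminaries.

(** * The law of the limit of lower corners of nested dyadic cells *)

Section dyadic_measure.
Context {R : realType} {m : nat}.
Local Notation letter := {ffun 'I_m -> bool}.
Local Notation T := (m.-tuple (measurableTypeR R)).

(** For [0 <= x], the number of cell indices of level [k] whose lower end is at most [x]. The
    corresponding dyadic number is the right end of the union of these cells: it exceeds [x < 1] by
    at most [2^-k], and the minimum caps it at 1. *)
Definition upper k (x : R) : nat := minn (2 ^ k) (Num.trunc (2 ^+ k * x)).+1.

Lemma dyadic_le_upper k n (x : R) : 0 <= x -> (n < 2 ^ k)%N ->
  (dyadic k n <= x) = (n < upper k x)%N.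
Proof.
move=> x0 nk; rewrite /upper leq_min nk/= ltnS truncn_ge_nat ?mulr_ge0//.
by rewrite /dyadic ler_pdivrMr ?exprn_gt0// mulrC.
Qed.

Lemma dyadicM k j n : dyadic (k + j) (n * 2 ^ j) = dyadic k n :> R.
Proof.
rewrite /dyadic exprD natrM natrX invfM mulrACA divff ?mulr1//.
Qed.

Lemma dyadic_upper1 k : dyadic k (upper k (1 : R)) = 1 :> R.
Proof.
rewrite /upper mulr1 (minn_idPl _); first by rewrite /dyadic natrX divff// expf_neq0.
by rewrite -natrX natrK.
Qed.

Lemma dyadic_upper_le1 k (x : R) : dyadic k (upper k x) <= 1 :> R.
Proof.
by rewrite /dyadic ler_pdivrMr ?exprn_gt0// mul1r -natrX ler_nat geq_minl.
Qed.

Lemma dyadic_upper_gt k (x : R) : 0 <= x < 1 -> x < dyadic k (upper k x).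
Proof.
move=> /andP[x0 x1]; rewrite /dyadic ltr_pdivlMr ?exprn_gt0// mulrC /upper.
rewrite /minn; case: ifP => _; first by rewrite natrX gtr_pMr ?exprn_gt0.
by rewrite truncnS_gt.
Qed.

Lemma dyadic_upper_cvg (x : R) : 0 <= x < 1 ->
  dyadic k (upper k x) @[k --> \oo] --> x.
Proof.
move=> x01; apply: (@squeeze_cvgr _ _ _ _ (fun=> x) (fun k => x + (2^-1) ^+ k)).
- apply: nearW => k; rewrite ltW ?dyadic_upper_gt//=.
  move: x01 => /andP[x0 x1]; rewrite /dyadic ler_pdivrMr ?exprn_gt0// mulrDl.
  rewrite -exprMn mulVf// expr1n.
  apply: (@le_trans _ _ (Num.trunc (2 ^+ k * x)).+1%:R); first by rewrite ler_nat geq_minr.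
  by rewrite -natr1 lerD2r mulrC truncn_le// mulr_ge0.
- exact: cvg_cst.
- rewrite -[X in _ --> X]addr0; apply: cvgD; first exact: cvg_cst.
  by apply: cvg_expr; rewrite ger0_norm ?invr_ge0// invf_lt1// ltr1n.
Qed.

Section limit_law.
Variable word : nat -> measurableTypeR R -> seq letter.
Hypothesis mword : forall k (S : seq letter -> bool), measurable [set u | S (word k u)].
Hypothesis word0 : forall u, word 0%N u = [::].
Hypothesis wordS : forall k u, exists c, word k.+1 u = c :: word k u.

Let size_word k u : size (word k u) = k.
Proof. by elim: k => [|k IH]; [rewrite word0|have [c ->] := wordS k u; rewrite /= IH]. Qed.

Let level i k (u : measurableTypeR R) : R := dyadic k (wnum (word k u) i).

Let level_lt i k u : (wnum (word k u) i < 2 ^ k)%N.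
Proof. by rewrite -[k in (2 ^ k)%N](size_word k u) wnum_lt. Qed.

Let wnum_word_div i k j u : (wnum (word (k + j) u) i %/ 2 ^ j)%N = wnum (word k u) i.
Proof.
elim: j => [|j IH]; first by rewrite addn0 divn1.
rewrite addnS expnS divnMA -IH; congr (_ %/ _)%N.
by have [c ->] := wordS (k + j) u; rewrite /=; case: (c i); lia.
Qed.

Let level_nd i u : nondecreasing_seq (level i ^~ u).
Proof.
apply/nondecreasing_seqP => k; rewrite /level -(dyadicS k).
have [c ->] := wordS k u; rewrite /dyadic/= ler_pM2r ?invr_gt0 ?exprn_gt0//.
by rewrite ler_nat leq_addr.
Qed.

Let level_le1 i k u : level i k u <= 1.
Proof.
by rewrite /level /dyadic ler_pdivrMr ?exprn_gt0// mul1r -natrX ler_nat ltnW.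
Qed.

Let level_cvg i u : cvgn (level i ^~ u).
Proof.
by apply: nondecreasing_is_cvgn => //; exists 1 => _ [k _ <-]; exact: level_le1.
Qed.

Let coord i u : R := limn (level i ^~ u).

Let coord_leP i u x : coord i u <= x <-> forall k, level i k u <= x.
Proof.
split=> [cx k|lx]; last by apply: limr_le => //; exact: nearW.
apply: le_trans cx.
exact: (nondecreasing_cvgn_le (level_nd i u) (@level_cvg i u) k).
Qed.

Let measurable_level i k : measurable_fun setT (level i k).
Proof.
move=> _ B mB; rewrite setTI.
by have := mword k (fun w => `[< B (dyadic k (wnum w i)) >]);
  under eq_set do rewrite asboolE.
Qed.

Let measurable_coord i : measurable_fun setT (coord i).
Proof.
apply: (@measurable_fun_cvg _ _ _ _ (level i)).
  exact: measurable_level.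
by move=> u _; exact: level_cvg.
Qed.

Definition limit_law u : T := [tuple coord i u | i < m].

Let measurable_limit_law : measurable_fun setT limit_law.
Proof.
apply/measurable_fun_tnthP => i; rewrite [X in measurable_fun _ X](_ : _ = coord i).
  exact: measurable_coord.
by apply/funext => u /=; rewrite tnth_mktuple.
Qed.

Let sub_level (x : T) i k : set (measurableTypeR R) :=
  if k is Some k then [set u | level i k u <= tnth x i] else [set u | coord i u <= tnth x i].

Let measurable_sub_level x i k : measurable (sub_level x i k).
Proof.
case: k => [k|]; rewrite /sub_level.
  have := @measurable_level i k measurableT _ (measurable_itv `]-oo, tnth x i]); rewrite setTI.
  by under eq_set do rewrite in_itv/=.
have := @measurable_coord i measurableT _ (measurable_itv `]-oo, tnth x i]); rewrite setTI.
by under eq_set do rewrite in_itv/=.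
Qed.

(** [a x kappa] is the mass of the event that, for every [i], the lower corner of level [kappa i],
    or the limit if the level is infinite, is at most [x_i] in coordinate [i]. Lower corners
    increase with the level, so these events decrease to the limit event in each level
    separately. *)
Lemma limit_law_limits (Q : {finite_measure set (measurableTypeR R) -> \bar R}) :
  exists (P : {finite_measure set T -> \bar R})
      (a : T -> ('I_m -> option nat) -> R),
    [/\ P setT = Q setT,
        forall x, cube x -> a x (fun=> None) = fine (P (rect (Defs.tuple0 m) x)),
        forall x kappa i, kappa i = None ->
          a x (set_level kappa i (Some k)) @[k --> \oo] --> a x kappa &
        forall x kappa, cube x -> let K := (\sum_i kappa i)%N in
          a x (Some \o kappa) = fine (Q [set u | [forall i,
            wnum (word K u) i < upper (kappa i) (tnth x i) * 2 ^ (K - kappa i)]%N])].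
Proof.
have [P PE] := finite_pushforward_ex Q measurable_limit_law.
exists P, (fun x kappa => fine (Q (box (sub_level x) kappa))); split.
- by rewrite PE.
- move=> x _; rewrite PE; congr (fine (Q _)); apply/seteqP; split=> u h i; have := h i;
    rewrite !tnth_mktuple/=; last by case/andP.
  move=> ->; rewrite andbT; apply: le_trans (nondecreasing_cvgn_le (level_nd i u) (@level_cvg i u) 0%N).
  by rewrite /level /dyadic mulr_ge0.
- move=> x kappa i ki; apply: box_cvg_decreasing => //.
  + move=> k l kl; rewrite subsetEset/= => u; apply: le_trans; exact: level_nd.
  + apply/seteqP; split=> u /=; first by move=> h; apply/coord_leP => k; exact: h.
    by move=> /coord_leP h k _; exact: h.
- move=> x kappa cx K; congr (fine (Q _)).
  (* [K] merely dominates all levels, so that one word of length [K] decides the events of all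
     coordinates; an ancestor's number is a quotient by a power of 2. *)
  have kK i : (kappa i <= K)%N by rewrite /K (bigD1 i)//= leq_addr.
  have equiv i u : (level i (kappa i) u <= tnth x i) =
      (wnum (word K u) i < upper (kappa i) (tnth x i) * 2 ^ (K - kappa i))%N.
    rewrite -ltn_divLR ?expn_gt0// -{1}(subnKC (kK i)) wnum_word_div.
    rewrite -dyadic_le_upper//.
    by have := cx i; rewrite !tnth_mktuple => /andP[].
  apply/seteqP; split=> u /=.
    by move=> h; apply/forallP => i; rewrite -equiv; exact: h.
  by move=> /forallP h i; rewrite /sub_level/= equiv.
Qed.

End limit_law.
End dyadic_measure.

(** * Measures realizing the quasi-volumes of a right-continuous function *)

Section vitali_measure.
Context {R : realType} {m : nat}.
Local Notation letter := {ffun 'I_m -> bool}.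
Local Notation T := (m.-tuple (measurableTypeR R)).
Implicit Types h : m.-tuple R -> R.

Lemma upd_id (c : m.-tuple R) i : upd c i (tnth c i) = c.
Proof. by apply: eq_from_tnth => j; rewrite tnth_mktuple; case: eqVneq => // ->. Qed.

(** Below 1 the dyadic approximants lie strictly to the right of the coordinate and converge to it;
    at 1 the cap makes the sequence constant. *)
Lemma coord_right_continuous_upper h (c : m.-tuple R) i :
  coord_right_continuous h -> cube c ->
  h (upd c i (dyadic k (upper k (tnth c i)))) @[k --> \oo] --> h c.
Proof.
move=> rc cc; have := cc i; rewrite !tnth_mktuple => /andP[c0].
rewrite le_eqVlt => /orP[/eqP c1|c1].
  rewrite [X in X @ _ --> _](_ : _ = (fun=> h c)); first exact: cvg_cst.
  by apply/funext => k; rewrite c1 dyadic_upper1 -c1 upd_id.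
have /cvg_at_rightP := rc c cc i c1.
move=> /(_ (fun k => dyadic k (upper k (tnth c i)))); apply; split.
  by move=> k; apply: dyadic_upper_gt; rewrite c0.
by apply: dyadic_upper_cvg; rewrite c0.
Qed.

Let upper_point (x : m.-tuple R) (kappa : 'I_m -> option nat) : m.-tuple R :=
  [tuple if kappa i is Some k then dyadic k (upper k (tnth x i)) else tnth x i | i < m].

Let upper_point_cube x kappa : cube x -> cube (upper_point x kappa).
Proof.
move=> cx i; have := cx i; rewrite !tnth_mktuple; case: (kappa i) => // k _.
by rewrite dyadic_upper_le1 andbT /dyadic mulr_ge0.
Qed.

(** A corner whose coordinate [i] is the lower one has it equal to 0 and does not move; every other
    corner moves in coordinate [i] alone, from the right. *)
Lemma quasi_volume_upper_cvg h (x : m.-tuple R) kappa i : coord_right_continuous h ->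
  cube x -> kappa i = None ->
  quasi_volume h (Defs.tuple0 m) (upper_point x (set_level kappa i (Some k))) @[k --> \oo]
  --> quasi_volume h (Defs.tuple0 m) (upper_point x kappa).
Proof.
move=> rc cx ki; apply: (@cvg_big R^o) => [|D _]; first exact: add_continuous.
apply: cvgM; first exact: cvg_cst.
set c := (X in _ --> h X).
have cc : cube c.
  move=> j; rewrite !tnth_mktuple.
  have := upper_point_cube kappa cx j; rewrite !tnth_mktuple.
  by case: (j \in D); rewrite ?mul0r ?addr0 // mul1r sub0r subrr lexx ler01.
have [iD|iD] := boolP (i \in D).
  rewrite [X in X @ _ --> _](_ : _ = (fun=> h c)); first exact: cvg_cst.
  apply/funext => k; congr h; apply: eq_from_tnth => j; rewrite !tnth_mktuple.
  rewrite /set_level; case: eqVneq => // ->; rewrite iD !mul1r !sub0r !subrr//.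
rewrite [X in X @ _ --> _](_ : _ =
  (fun k => h (upd c i (dyadic k (upper k (tnth c i)))))).
  exact: coord_right_continuous_upper.
apply/funext => k; congr h; apply: eq_from_tnth => j; rewrite !tnth_mktuple.
rewrite /set_level; case: eqVneq => // ->.
by rewrite (negbTE iD) !mul0r !addr0 ki.
Qed.

(** The weights of the two trees differ by the quasi-volume of a cell and add up to its variation.
    The difference identifies the distribution function, and the sum at the root bounds the total
    mass. *)
Lemma vitali_charge h : (vitali h < +oo)%E -> coord_right_continuous h ->
  exists P N : {finite_measure set T -> \bar R},
    (forall x, cube x -> fine (P (rect (Defs.tuple0 m) x)) -
      fine (N (rect (Defs.tuple0 m) x)) = quasi_volume h (Defs.tuple0 m) x) /\
    (P setT + N setT <= vitali h)%E.
Proof.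
move=> h_lty rc.
have h_fin : vitali h \is a fin_num.
  by rewrite ge0_fin_numE//; apply: le_trans (wsum_cell_volume_le h 0); rewrite lee_fin sumr_ge0.
have [|mu [mu_ge mu_split mu_nil]] := @variation_tree _ _ h (fine (vitali h)).
  by rewrite fineK.
pose M (b : bool) w := (mu w + (-1) ^+ b * cell_volume h w) / 2.
have M_ge0 b w : 0 <= M b w.
  rewrite /M divr_ge0//; have := mu_ge w; rewrite ler_norml => /andP[h1 h2].
  by case: b; rewrite ?expr1 ?expr0 ?mulN1r ?mul1r; lra.
have M_split b w : M b w = \sum_c M b (c :: w).
  by rewrite /M -mulr_suml big_split/= -mulr_sumr -mu_split -cell_volume_split.
have c0 : letter := [ffun=> false].
have H b := tree_measure c0 (M_ge0 b) (M_split b).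
have [QP [wordP [mP QPE wP0 wPS]]] := H false.
have [QN [wordN [mN QNE wN0 wNS]]] := H true.
have [P [aP [PT aPE aPcvg aP0]]] := limit_law_limits mP wP0 wPS QP.
have [N [aN [NT aNE aNcvg aN0]]] := limit_law_limits mN wN0 wNS QN.
exists P, N; split; last first.
  have QT b (Q : {finite_measure set (measurableTypeR R) -> \bar R}) word :
      (forall k (S : seq letter -> bool), Q [set u | S (word k u)] =
        (\sum_(w : k.-tuple letter) (S w)%:R * M b w)%:E) -> Q setT = (M b [::])%:E.
    move=> QE; have := QE 0%N (fun=> true); rewrite -[RHS]/((wsum 0 (fun w => 1 * M b w))%:E).
    by rewrite wsum0 mul1r => <-; congr (Q _); apply/seteqP; split.
  rewrite PT NT (QT _ _ _ QPE) (QT _ _ _ QNE) -EFinD -(fineK h_fin) lee_fin.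
  by apply: le_trans mu_nil; rewrite /M expr0 expr1 mul1r mulN1r; lra.
move=> x cx; rewrite -aPE// -aNE//.
have -> : quasi_volume h (Defs.tuple0 m) x =
    quasi_volume h (Defs.tuple0 m) (upper_point x (fun=> None)).
  by congr quasi_volume; apply: eq_from_tnth => i; rewrite tnth_mktuple.
pose a kappa := aP x kappa - aN x kappa.
pose b kappa := quasi_volume h (Defs.tuple0 m) (upper_point x kappa).
rewrite -[LHS]/(a (fun=> None)) -[RHS]/(b (fun=> None)).
rewrite (@iterated_limit _ _ a b)//.
(* At finite levels both sides are the quasi-volume over one dyadic box: the cells of depth [K]
   selected by the event tile it. *)
- move=> kappa; rewrite /a aP0// aN0//; set K := (\sum_i kappa i)%N.
  have kK i : (kappa i <= K)%N by rewrite /K (bigD1 i)//= leq_addr.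
  pose NN i := (upper (kappa i) (tnth x i) * 2 ^ (K - kappa i))%N.
  rewrite (QPE K (fun w => [forall i, wnum w i < NN i]%N)).
  rewrite (QNE K (fun w => [forall i, wnum w i < NN i]%N)) /=.
  transitivity (wsum K (fun w => [forall i, wnum w i < NN i]%N%:R * cell_volume h w)).
    rewrite -sumrB; apply: eq_bigr => w _; rewrite -mulrBr /M; congr (_ * _).
    by rewrite expr0 expr1; field.
  rewrite cell_volume_grid; last first.
    move=> i; rewrite /NN -{2}(subnKC (kK i)) expnD leq_mul2r geq_minl orbT//.
  congr quasi_volume; apply: eq_from_tnth => i; rewrite !tnth_mktuple/= /NN.
  by rewrite -{1}(subnKC (kK i)) dyadicM.
- by move=> kappa i ki; apply: cvgB; [exact: aPcvg|exact: aNcvg].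
- by move=> kappa i ki; exact: quasi_volume_upper_cvg.
Qed.

End vitali_measure.

(** * Signed measures on the cube *)

Section charges.
Context d (T : measurableType d) {R : realType}.
Implicit Types nu : {charge set T -> \bar R}.

Lemma jordan_decompE nu A : measurable A ->
  nu A = (jordan_pos (hahn_pair nu) A - jordan_neg (hahn_pair nu) A)%E.
Proof.
move=> mA; rewrite [LHS](jordan_decomp (hahn_pair nu) mA).
rewrite -[LHS]/(jordan_pos _ A + cscale (-1) (jordan_neg _) A)%E.
by congr (_ + _)%E; rewrite /cscale mulN1e.
Qed.

(** Minimality of the Jordan decomposition: on each Hahn part the variation is [P - N] or [N - P],
    hence at most [P + N], and the two parts partition [A]. *)
Lemma charge_variation_le nu X Y (nuXY : hahn_decomposition nu X Y)
    (P N : {finite_measure set T -> \bar R}) A :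
  (forall B, measurable B -> nu B = (P B - N B)%E) -> measurable A ->
  (charge_variation nuXY A <= P A + N A)%E.
Proof.
move=> nuE mA.
rewrite -[leLHS]/(jordan_pos nuXY A + jordan_neg nuXY A)%E jordan_posE jordan_negE.
rewrite cjordan_posE cjordan_negE /crestr0 mem_set// /crestr.
have [[mX _] [mY _] XY XY0] := nuXY.
have mAX : measurable (A `&` X) by exact: measurableI.
have mAY : measurable (A `&` Y) by exact: measurableI.
rewrite !nuE// oppeB ?fin_num_adde_defr ?fin_num_measure//.
have AE : A = (A `&` X) `|` (A `&` Y) by rewrite -setIUr XY setIT.
have AXY : A `&` X `&` (A `&` Y) = set0 by rewrite setIACA XY0 setI0.
have muA (mu : {finite_measure set T -> \bar R}) :
    mu A = (mu (A `&` X) + mu (A `&` Y))%E.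
  by rewrite -measureU// -AE.
have subD (x y : \bar R) : (0 <= y -> x - y <= x + y)%E.
  by move=> y0; rewrite leeD2l// (le_trans _ y0)// oppe_le0.
rewrite (muA P) (muA N) addeACA; apply: leeD; first exact: subD.
by rewrite addeC [leRHS]addeC; exact: subD.
Qed.

Lemma total_variation_le nu (P N : {finite_measure set T -> \bar R}) A :
  (forall B, measurable B -> nu B = (P B - N B)%E) -> measurable A ->
  (Defs.total_variation nu A <= P A + N A)%E.
Proof. exact: charge_variation_le. Qed.

End charges.

Section tuple_measurability.
Context {R : realType} {m : nat}.
Local Notation T := (m.-tuple (measurableTypeR R)).

Lemma measurable_coord_preimage i (S : set (measurableTypeR R)) : measurable S ->
  measurable [set t : T | S (tnth t i)].
Proof.
move=> mS; have := @measurable_tnth _ (measurableTypeR R) m i measurableT S mS.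
by rewrite setTI.
Qed.

Lemma measurable_rect (u v : m.-tuple R) : measurable (rect u v : set T).
Proof.
apply: measurable_forall_ord => i.
have := @measurable_coord_preimage i _ (measurable_itv `[tnth u i, tnth v i]).
by under eq_set do rewrite /= in_itv/=.
Qed.

Lemma measurable_hcube : measurable (hcube : set T).
Proof.
apply: measurable_forall_ord => i.
have := @measurable_coord_preimage i _ (measurable_itv `[0, 1[).
by under eq_set do rewrite /= in_itv/=.
Qed.

Lemma measurable_tuple1 (x : m.-tuple R) : measurable ([set x] : set T).
Proof.
rewrite (_ : [set x] = rect x x); first exact: measurable_rect.
apply/seteqP; split => [t -> i|t xt]; first by rewrite lexx.
by apply: eq_from_tnth => i; apply/eqP; rewrite eq_le andbC; exact: xt.
Qed.

Lemma measurable_hcube_punctured : measurable (hcube `\ Defs.tuple0 m : set T).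
Proof. by apply: measurableD; [exact: measurable_hcube|exact: measurable_tuple1]. Qed.

End tuple_measurability.

Lemma measurable_face (R : realType) m (B : {set 'I_m}) :
  measurable_fun setT (@face R m B : #|B|.-tuple (measurableTypeR R) -> m.-tuple (measurableTypeR R)).
Proof.
apply/measurable_fun_tnthP => i.
have [iB|iB] := boolP (i \in B); last first.
  rewrite [X in measurable_fun _ X](_ : _ = cst 0); first exact: measurable_cst.
  by apply/funext => y /=; rewrite tnth_face_out.
rewrite [X in measurable_fun _ X](_ : _ = @tnth _ (measurableTypeR R) ^~ (enum_rank_in iB i)).
  exact: measurable_tnth.
by apply/funext => y /=; rewrite -{1}(enum_rankK_in iB iB) tnth_face_val.
Qed.

(** * Signed measures with a prescribed distribution function *)

Section existence.
Context {R : realType} {m : nat}.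
Local Notation T := (m.-tuple (measurableTypeR R)).
Local Notation origin := (Defs.tuple0 m : m.-tuple R).
Implicit Types g : m.-tuple R -> R.

Lemma cubeP n (x : n.-tuple R) : cube x <-> forall i, 0 <= tnth x i <= 1.
Proof. by split => cx i; have := cx i; rewrite !tnth_mktuple. Qed.

Lemma rect0P n (x t : n.-tuple R) :
  rect (Defs.tuple0 n) x t <-> forall i, 0 <= tnth t i <= tnth x i.
Proof. by split => h i; have := h i; rewrite tnth_mktuple. Qed.

Lemma cube_face (B : {set 'I_m}) (y : #|B|.-tuple R) : cube y -> cube (face y).
Proof.
move=> /cubeP cy; apply/cubeP => j.
have [jB|jB] := boolP (j \in B); last by rewrite tnth_face_out// lexx ler01.
by have := cy (enum_rank_in jB j); rewrite -(tnth_face_val y) enum_rankK_in.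
Qed.

Lemma face_upd (B : {set 'I_m}) (y : #|B|.-tuple R) i r :
  face (upd y i r) = upd (face y) (enum_val i) r.
Proof.
apply: eq_from_tnth => j; rewrite [RHS]tnth_mktuple.
have [jB|jB] := boolP (j \in B); last first.
  rewrite !tnth_face_out//; case: eqVneq => // jE; move: jB; rewrite jE.
  by rewrite enum_valP.
rewrite -(enum_rankK_in jB jB) !tnth_face_val tnth_mktuple.
by rewrite (inj_eq enum_val_inj).
Qed.

Lemma coord_right_continuous_face (B : {set 'I_m}) g : coord_right_continuous g ->
  coord_right_continuous (fun y => g (@face R m B y)).
Proof.
move=> rc y cy i yi; under eq_fun do rewrite face_upd.
by have := rc _ (cube_face cy) (enum_val i); rewrite tnth_face_val => /(_ yi).
Qed.

Lemma sub_tuple_cube (B : {set 'I_m}) (x : m.-tuple R) : cube x -> cube (sub_tuple B x).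
Proof. by move=> cx i; have := cx (enum_val i); rewrite !tnth_mktuple. Qed.

Lemma preimage_face_rect (B : {set 'I_m}) (x : m.-tuple R) : cube x ->
  @face R m B @^-1` rect origin x = rect (Defs.tuple0 #|B|) (sub_tuple B x).
Proof.
move=> /cubeP cx; apply/seteqP; split => y /= /rect0P h; apply/rect0P => i.
  by have := h (enum_val i); rewrite tnth_face_val tnth_sub_tuple.
have [iB|iB] := boolP (i \in B); last first.
  by rewrite tnth_face_out//; have := cx i; rewrite lexx => /andP[].
have := h (enum_rank_in iB i); rewrite tnth_sub_tuple -(tnth_face_val y).
by rewrite enum_rankK_in.
Qed.

(** For a nonempty face the measures of the restricted function are pushed forward into the cube.
    The empty face accounts for [g] at the origin by a point mass there, which the bound ignores, as
    [VHK0] has no term for that face. *)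
Lemma face_charge g (B : {set 'I_m}) : (VHK0 g < +oo)%E -> coord_right_continuous g ->
  exists P N : {finite_measure set T -> \bar R},
    (forall x, cube x -> fine (P (rect origin x)) - fine (N (rect origin x)) =
       quasi_volume (fun y => g (@face R m B y)) (Defs.tuple0 #|B|) (sub_tuple B x)) /\
    (P (~` [set origin]) + N (~` [set origin]) <=
       if (0 < #|B|)%N then vitali (fun y => g (@face R m B y)) else 0)%E.
Proof.
move=> gV rc; case: ifPn => [B0|].
  have vB : (vitali (fun y => g (@face R m B y)) < +oo)%E.
    apply: le_lt_trans gV; rewrite /VHK0 (bigD1 B)//= leeDl// sume_ge0// => C C0.
    by apply: le_trans (wsum_cell_volume_le _ 0); rewrite lee_fin sumr_ge0.
  have [P [N [PN PNle]]] := vitali_charge vB (@coord_right_continuous_face B g rc).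
  have [P' P'E] := finite_pushforward_ex P (@measurable_face R m B).
  have [N' N'E] := finite_pushforward_ex N (@measurable_face R m B).
  exists P', N'; split.
    move=> x cx; rewrite P'E N'E preimage_face_rect// PN//.
    exact: sub_tuple_cube.
  apply: le_trans PNle; rewrite P'E N'E; apply: leeD; apply: le_measure => //; rewrite inE//;
    have := @measurable_face R m B measurableT _ (measurableC (@measurable_tuple1 R m origin));
    by rewrite setTI.
rewrite -eqn0Ngt => /eqP B0.
pose D (r : {nonneg R}) : {finite_measure set T -> \bar R} :=
  mscale r (dirac (origin : T) : {finite_measure set T -> \bar R}).
have r0 (r : R) : 0 <= Num.max r 0 by rewrite le_max lexx orbT.
(* The positive and negative parts of the value at the origin, as masses of Dirac measures. *)
exists (D (NngNum (r0 (g origin)))), (D (NngNum (r0 (- g origin)))).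
have DA r A : D r A = (r%:num%:E * \d_(origin : T) A)%E by [].
have DE r x : cube x -> fine (D r (rect origin x)) = r%:num.
  move=> cx; rewrite DA diracE mem_set ?mule1//.
  by apply/rect0P => i; rewrite tnth_mktuple lexx; have /cubeP/(_ i)/andP[] := cx.
split.
  move=> x cx; rewrite !DE//=.
  have -> : quasi_volume (fun y => g (@face R m B y)) (Defs.tuple0 #|B|) (sub_tuple B x)
    = g origin.
    rewrite /quasi_volume (big_pred1 finset.set0).
      rewrite cards0 expr0 mul1r; congr g; apply: eq_from_tnth => i.
      by rewrite tnth_face_out ?tnth_mktuple//; move/eqP: B0; rewrite cards_eq0 => /eqP ->; rewrite inE.
    by move=> D'; apply/esym/eqP/finset.setP => -[i iB]; exfalso; move: iB; rewrite B0.
  rewrite /Num.max; have [h1|h1] := ltP (g origin) 0;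
    have [h2|h2] := ltP (- g origin) 0; lra.
rewrite !DA !diracE memNset//= !mule0 adde0//.
Qed.

(** Only a coordinate equal to 1 is moved, because left continuity is assumed nowhere else. *)
Definition lower k (x : R) : R := if x < 1 then x else 1 - 2^-1 ^+ k.

Let lower01 k x : 0 <= x <= 1 -> 0 <= lower k x <= 1.
Proof.
rewrite /lower; case: ifP => // _ _.
have h0 : 0 <= 2^-1 ^+ k :> R by rewrite exprn_ge0.
have h1 : 2^-1 ^+ k <= 1 :> R by rewrite exprn_ile1// invf_le1// ler1n.
by apply/andP; split; lra.
Qed.

Let lower_point (x : m.-tuple R) (kappa : 'I_m -> option nat) : m.-tuple R :=
  [tuple if kappa i is Some k then lower k (tnth x i) else tnth x i | i < m].

Let lower_point_cube x kappa : cube x -> cube (lower_point x kappa).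
Proof.
by move=> cx i; have := cx i; rewrite !tnth_mktuple; case: (kappa i) => // k /(lower01 k).
Qed.

Let half_pow_cvg : 1 - 2^-1 ^+ k @[k --> \oo] --> (1 : R).
Proof.
rewrite -[X in _ --> X]subr0; apply: cvgB; first exact: cvg_cst.
by apply: cvg_expr; rewrite ger0_norm ?invr_ge0// invf_lt1// ltr1n.
Qed.

Let half_pow_lt1 k : 1 - 2^-1 ^+ k < 1 :> R.
Proof. by rewrite ltrBlDr ltrDl exprn_gt0. Qed.

Lemma lower_point_cvg g x kappa i : coord_left_continuous_at1 g -> cube x ->
  kappa i = None ->
  g (lower_point x (set_level kappa i (Some k))) @[k --> \oo] --> g (lower_point x kappa).
Proof.
move=> lc cx ki; set c := lower_point x kappa.
have ci : tnth c i = tnth x i by rewrite tnth_mktuple ki.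
have cE k : lower_point x (set_level kappa i (Some k)) = upd c i (lower k (tnth x i)).
  apply: eq_from_tnth => j; rewrite !tnth_mktuple /set_level.
  by case: eqVneq => // ->.
under eq_fun do rewrite cE.
have /cubeP/(_ i)/andP[_] := cx; rewrite le_eqVlt => /orP[/eqP x1|x1].
  have c1 : tnth c i = 1 by rewrite ci.
  have cc : (cube `\` hcube) c.
    by split; [exact: lower_point_cube|move=> /(_ i); rewrite c1 ltxx andbF].
  have /cvg_at_leftP := lc c cc i c1.
  rewrite c1 x1 => /(_ (fun k => 1 - 2^-1 ^+ k)) h.
  by rewrite /lower ltxx; apply: h; split; [exact: half_pow_lt1|exact: half_pow_cvg].
rewrite /lower x1 -ci; under eq_fun do rewrite upd_id.
exact: cvg_cst.
Qed.

(* Left continuity at 1 says that the faces [x_i = 1] carry no mass, so that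
   cutting the measures down to [hcube] loses nothing. *)
Lemma restrict_hcube g (P N : {finite_measure set T -> \bar R}) :
  coord_left_continuous_at1 g ->
  (forall x, cube x -> fine (P (rect origin x)) - fine (N (rect origin x)) = g x) ->
  forall x, cube x -> fine (P (rect origin x `&` hcube)) -
    fine (N (rect origin x `&` hcube)) = g x.
Proof.
move=> lc PN x cx.
(* If [x_i < 1] all levels give the same set; if [x_i = 1] the sets increase to [0 <= t_i < 1]. The
   limit box is thus the rectangle cut down to [hcube]. *)
pose G i k : set T := if k is Some k then [set t | 0 <= tnth t i <= lower k (tnth x i)]
  else [set t | 0 <= tnth t i <= tnth x i /\ tnth t i < 1].
have mG i k : measurable (G i k).
  case: k => [k|]; rewrite /G.
    have := @measurable_coord_preimage R m i _ (measurable_itv `[0, lower k (tnth x i)]).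
    by under eq_set do rewrite /= in_itv/=.
  apply: measurableI.
    have := @measurable_coord_preimage R m i _ (measurable_itv `[0, tnth x i]).
    by under eq_set do rewrite /= in_itv/=.
  have := @measurable_coord_preimage R m i _ (measurable_itv `]-oo, 1[).
  by under eq_set do rewrite /= in_itv/=.
pose a kappa := fine (P (box G kappa)) - fine (N (box G kappa)).
pose b kappa := g (lower_point x kappa).
have ndG i : nondecreasing_seq (fun k => G i (Some k)).
  move=> k l kl; rewrite subsetEset => t /= /andP[-> /le_trans]; apply.
  rewrite /lower; case: ifP => // _; rewrite lerD2l lerN2.
  by apply: ler_wiXn2l => //; rewrite invf_le1// ler1n.
have GN i : \bigcup_k G i (Some k) = G i None.
  have /cubeP/(_ i)/andP[x0 x1] := cx.
  apply/seteqP; split => t /=.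
    move=> [k _] /= /andP[-> tl]; have := half_pow_lt1 k.
    move: tl; rewrite /lower; case: ltP => h1 h2 h3; split; lra.
  move=> [/andP[t0 tx] t1]; rewrite /lower.
  have [xi1|xi1] := ltP (tnth x i) 1.
    by exists 0%N => //=; rewrite t0.
  have /cvgrPdist_lt/(_ (1 - tnth t i)) := half_pow_cvg.
  rewrite subr_gt0 => /(_ t1)[k _ /(_ k (leqnn k))]/= hk.
  exists k => //=; rewrite t0/=; move: hk.
  rewrite opprB addrCA subrr addr0 ger0_norm ?exprn_ge0 ?invr_ge0//; lra.
have -> : g x = b (fun=> None).
  by rewrite /b; congr g; apply: eq_from_tnth => i; rewrite tnth_mktuple.
have -> : rect origin x `&` hcube = box G (fun=> None).
  apply/seteqP; split => t.
    by move=> [h1 h2] i; have := h1 i; have /andP[_] := h2 i; rewrite tnth_mktuple.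
  move=> h; split => i; have /= [h1 h2] := h i; first by rewrite tnth_mktuple.
  by case/andP: h1 => ->.
rewrite -[LHS]/(a (fun=> None)) (@iterated_limit _ _ a b)//.
- move=> kappa; rewrite /a /b -PN; last exact: lower_point_cube.
  suff -> : box G (Some \o kappa) = rect origin (lower_point x (Some \o kappa)) by [].
  by apply/seteqP; split=> t h i; have := h i; rewrite /G/= !tnth_mktuple.
- by move=> kappa i ki; apply: cvgB; apply: box_cvg_increasing.
- by move=> kappa i ki; exact: lower_point_cvg.
Qed.

(** The measures of the faces are added up: their distribution functions sum to [g] by
    [quasi_volume_face_sum], and their masses off the origin to at most [VHK0 g]. Restricting to
    [hcube] can only lower these masses. *)
Lemma density_charge g : (VHK0 g < +oo)%E -> coord_right_continuous g ->
    coord_left_continuous_at1 g ->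
  exists P N : {finite_measure set T -> \bar R},
    [/\ forall A, A `&` hcube = set0 -> P A = 0%E /\ N A = 0%E,
        forall x, cube x -> fine (P (rect origin x)) - fine (N (rect origin x)) = g x &
        (P (hcube `\ origin) + N (hcube `\ origin) <= VHK0 g)%E].
Proof.
move=> gV rc lc.
have [PB /choice[NB H]] := choice (fun B => face_charge B gV rc).
have [P PE] := finite_measure_sum_ex (index_enum {set 'I_m}) xpredT PB.
have [N NE] := finite_measure_sum_ex (index_enum {set 'I_m}) xpredT NB.
have PN x : cube x -> fine (P (rect origin x)) - fine (N (rect origin x)) = g x.
  move=> cx; have mr := @measurable_rect R m origin x.
  rewrite PE NE -!sum_fine; try by move=> i _; exact: fin_num_measure.
  rewrite -sumrB quasi_volume_face_sum; apply: eq_bigr => B _.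
  by have [] := H B; move=> ->.
have [P' P'E] := finite_mrestr_ex P (@measurable_hcube R m).
have [N' N'E] := finite_mrestr_ex N (@measurable_hcube R m).
have mo : measurable (~` [set origin] : set T).
  by apply: measurableC; exact: measurable_tuple1.
have mh := @measurable_hcube_punctured R m.
exists P', N'; split.
- by move=> A A0; rewrite P'E N'E A0 !measure0.
- by move=> x cx; rewrite P'E N'E; exact: restrict_hcube.
- rewrite P'E N'E setIidl; last by move=> t [].
  apply: (@le_trans _ _ (P (~` [set origin]) + N (~` [set origin]))%E).
    by apply: leeD; apply: le_measure; rewrite ?inE// => t [].
  rewrite PE NE -big_split/= /VHK0 [leRHS]big_mkcond/=; apply: lee_sum => B _.
  by have [] := H B.
Qed.

End existence.

(** * Uniqueness of a signed measure with a given distribution function *)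

Section orthants.
Context {R : realType} {m : nat}.
Local Notation T := (m.-tuple (measurableTypeR R)).

(** Orthants are closed under intersection, generate the measurable sets and cover the space, as
    uniqueness of measures demands; rectangles anchored at the origin do not see points with a
    negative coordinate. *)
Definition orthant (x : m.-tuple R) : set T := [set t | forall i, tnth t i <= tnth x i].

Lemma measurable_orthant x : measurable (orthant x).
Proof.
apply: measurable_forall_ord => i.
have := @measurable_coord_preimage R m i _ (measurable_itv `]-oo, tnth x i]).
by under eq_set do rewrite /= in_itv/=.
Qed.

Lemma orthantI x y : orthant x `&` orthant y =
  orthant [tuple Num.min (tnth x i) (tnth y i) | i < m].
Proof.
apply/seteqP; split => t.
  by move=> [hx hy] i; rewrite tnth_mktuple le_min hx hy.
by move=> h; split => i; have := h i; rewrite tnth_mktuple le_min => /andP[].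
Qed.

Lemma orthant_cover : \bigcup_k orthant [tuple k%:R | i < m] = setT.
Proof.
apply/seteqP; split => // t _.
exists (\sum_i (Num.trunc (tnth t i)).+1)%N => //= i; rewrite tnth_mktuple.
rewrite (bigD1 i)//= natrD ler_wpDr// ltW//.
by rewrite truncnS_gt.
Qed.

Lemma orthant_generate : (measurable : set (set T)) = <<s range orthant >>.
Proof.
apply/seteqP; split; last first.
  apply: smallest_sub; first exact: sigma_algebra_measurable.
  by move=> _ [x _ <-]; exact: measurable_orthant.
pose T' := g_sigma_algebraType (range orthant).
have mid : measurable_fun [set: T'] (idfun : T' -> T).
  apply/measurable_fun_tnthP => i.
  apply: (@measurability _ _ _ _ _ _ _ (RGenOInfty.measurableE R)).
  move=> _ [_ [a ->] <-]; rewrite setTI.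
  (* The half-space [t_i <= a] is exhausted by orthants whose other bounds grow. *)
  rewrite [X in measurable X](_ : _ = ~` (\bigcup_k
    (orthant [tuple if j == i then a else k%:R | j < m] : set T'))).
    apply: measurableC; apply: bigcupT_measurable => k; apply: sub_sigma_algebra.
    by exists [tuple if j == i then a else k%:R | j < m].
  apply/seteqP; split => t /=; rewrite in_itv/= andbT.
    by move=> ai [k _ /(_ i)]; rewrite tnth_mktuple eqxx leNgt ai.
  move=> h; rewrite ltNge; apply/negP => ta; apply: h.
  have : [set: T] t by [].
  rewrite -orthant_cover => -[k _ hk]; exists k => // j; have := hk j.
  by rewrite !tnth_mktuple; case: eqVneq => // ->.
by move=> A mA; have := mid measurableT A mA; rewrite setTI.
Qed.

Lemma orthant_measure_unique (m1 m2 : {finite_measure set T -> \bar R}) :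
  (forall x, m1 (orthant x) = m2 (orthant x)) ->
  forall A : set T, measurable A -> m1 A = m2 A.
Proof.
move=> m12 A mA.
apply: (@measure_unique _ _ _ (range orthant) (fun k => orthant [tuple k%:R | i < m])
  orthant_generate _ _ orthant_cover) mA.
- by move=> _ _ [x _ <-] [y _ <-]; rewrite orthantI; eexists.
- by move=> k; exact: imageT.
- by move=> _ [x _ <-]; exact: m12.
- by move=> k; rewrite ltey_eq fin_num_measure//; exact: measurable_orthant.
Qed.

(* A measure carried by [hcube] only sees an orthant through a rectangle
   anchored at the origin. *)
Lemma orthant_hcube (x : m.-tuple R) :
  (exists2 z, cube z & orthant x `&` hcube = rect (Defs.tuple0 m) z `&` hcube) \/
  orthant x `&` hcube = set0.
Proof.
have [x0|/forallPn[i xi]] := boolP [forall i, 0 <= tnth x i]; last first.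
  right; rewrite -subset0 => t [/(_ i) h1 /(_ i)/andP[h2 _]].
  by move: xi; rewrite (le_trans h2 h1).
left; exists [tuple Num.min (tnth x i) 1 | i < m].
  by apply/cubeP => i; rewrite tnth_mktuple le_min (forallP x0) ler01 ge_min lexx orbT.
apply/seteqP; split => t [ht th]; split => //.
  by apply/rect0P => i; rewrite tnth_mktuple le_min ht; have /andP[-> /ltW ->] := th i.
by move=> i; have /rect0P/(_ i) := ht; rewrite tnth_mktuple le_min => /andP[_ /andP[]].
Qed.

Lemma finite_measure_hcube (P : {finite_measure set T -> \bar R}) :
  (forall A : set T, measurable A -> A `&` hcube = set0 -> P A = 0%E) ->
  forall A : set T, measurable A -> P A = P (A `&` hcube).
Proof.
move=> P0 A mA; have mh := @measurable_hcube R m.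
rewrite -[in LHS](setIT A) -(setUv hcube) setIUr measureU//.
- by rewrite [X in (_ + X)%E]P0 ?adde0//; [apply: measurableI => //; exact: measurableC|rewrite -setIA setICl setI0].
- exact: measurableI.
- by apply: measurableI => //; exact: measurableC.
- by rewrite setIACA setICr setI0.
Qed.

(** Moving the subtracted measures across reduces the claim to the positive measures [P + N'] and
    [P' + N], which agree on orthants. *)
Lemma rect_charge_unique (P N P' N' : {finite_measure set T -> \bar R}) :
  (forall Q, (Q = P \/ Q = N) \/ (Q = P' \/ Q = N') ->
     forall A : set T, measurable A -> A `&` hcube = set0 -> Q A = 0%E) ->
  (forall x, cube x ->
    fine (P (rect (Defs.tuple0 m) x)) - fine (N (rect (Defs.tuple0 m) x)) =
    fine (P' (rect (Defs.tuple0 m) x)) - fine (N' (rect (Defs.tuple0 m) x))) ->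
  forall A : set T, measurable A -> (P A - N A = P' A - N' A)%E.
Proof.
move=> carr PN A mA.
have cP := carr P (or_introl (or_introl erefl)).
have cN := carr N (or_introl (or_intror erefl)).
have cP' := carr P' (or_intror (or_introl erefl)).
have cN' := carr N' (or_intror (or_intror erefl)).
pose add2 (Q1 Q2 : {finite_measure set T -> \bar R}) (b : bool) := if b then Q1 else Q2.
have [m1 m1E'] := finite_measure_sum_ex (index_enum bool) xpredT (add2 P N').
have [m2 m2E'] := finite_measure_sum_ex (index_enum bool) xpredT (add2 P' N).
have m1E B : m1 B = (P B + N' B)%E by rewrite m1E' big_bool.
have m2E B : m2 B = (P' B + N B)%E by rewrite m2E' big_bool.
have mr x := @measurable_rect R m (Defs.tuple0 m) x.
have m12 : m1 A = m2 A.
  apply: orthant_measure_unique mA => x; rewrite m1E m2E.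
  have mo := measurable_orthant x.
  rewrite (finite_measure_hcube cP)// (finite_measure_hcube cN)//.
  rewrite (finite_measure_hcube cP')// (finite_measure_hcube cN')//.
  have [[z cz ->]|->] := orthant_hcube x; last by rewrite !measure0.
  rewrite -(finite_measure_hcube cP)// -(finite_measure_hcube cN)//.
  rewrite -(finite_measure_hcube cP')// -(finite_measure_hcube cN')//.
  have := PN z cz => /eqP; rewrite subr_eq addrAC eq_sym subr_eq => /eqP E.
  rewrite -(fineK (fin_num_measure P _ (mr z))) -(fineK (fin_num_measure N _ (mr z))).
  rewrite -(fineK (fin_num_measure P' _ (mr z))) -(fineK (fin_num_measure N' _ (mr z))).
  by rewrite -!EFinD E.
move: m12; rewrite m1E m2E.
rewrite -(fineK (fin_num_measure P _ mA)) -(fineK (fin_num_measure N _ mA)).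
rewrite -(fineK (fin_num_measure P' _ mA)) -(fineK (fin_num_measure N' _ mA)).
by rewrite -!EFinB -!EFinD => -[E]; congr EFin; lra.
Qed.

End orthants.

(** * One-sided continuity of distribution functions *)

Section one_sided_limits.
Context {R : realType}.

(** For [a < s < r k] the value [F s] lies between [F a] and [F (r k)], so one sequence suffices.
    This turns continuity of measures along sequences into a limit in the real variable. *)
Lemma nondecreasing_cvg_right (F : R -> R) (a : R) (r : nat -> R) :
  {homo F : s t / s <= t} -> (forall k, a < r k) -> F (r k) @[k --> \oo] --> F a ->
  F s @[s --> a^'+] --> F a.
Proof.
move=> Fnd ar Fr; apply/cvgrPdist_lt => e e0.
have /cvgrPdist_lt/(_ e e0)[k _ /(_ k (leqnn k)) /= hk] := Fr.
near=> s; have /andP[sa sr] : a < s < r k.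
  apply/andP; split; first by near: s; exact: nbhs_right_gt.
  by near: s; exact: nbhs_right_lt.
move: hk; have := Fnd _ _ (ltW sa); have := Fnd _ _ (ltW sr).
by rewrite !ltr_norml => h1 h2 /andP[h3 h4]; apply/andP; split; lra.
Unshelve. all: by end_near. Qed.

Lemma nondecreasing_cvg_left (F : R -> R) (a : R) (r : nat -> R) :
  {homo F : s t / s <= t} -> (forall k, r k < a) -> F (r k) @[k --> \oo] --> F a ->
  F s @[s --> a^'-] --> F a.
Proof.
move=> Fnd ar Fr; apply/cvgrPdist_lt => e e0.
have /cvgrPdist_lt/(_ e e0)[k _ /(_ k (leqnn k)) /= hk] := Fr.
near=> s; have /andP[sa sr] : r k < s < a.
  apply/andP; split; last by near: s; exact: nbhs_left_lt.
  by near: s; exact: nbhs_left_gt.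
move: hk; have := Fnd _ _ (ltW sa); have := Fnd _ _ (ltW sr).
by rewrite !ltr_norml => h1 h2 /andP[h3 h4]; apply/andP; split; lra.
Unshelve. all: by end_near. Qed.

End one_sided_limits.

Section distribution_function.
Context {R : realType} {m : nat}.
Local Notation T := (m.-tuple (measurableTypeR R)).
Local Notation origin := (Defs.tuple0 m : m.-tuple R).
Variable P : {finite_measure set T -> \bar R}.

Definition distribution (x : m.-tuple R) : R := fine (P (rect origin x)).

Let distribution_upd_homo x j :
  {homo (fun r => distribution (upd x j r)) : s t / s <= t}.
Proof.
move=> s t st; apply: fine_le; try by apply: fin_num_measure; exact: measurable_rect.
apply: le_measure; rewrite ?inE; try exact: measurable_rect.
move=> y /rect0P h; apply/rect0P => i; have := h i; rewrite !tnth_mktuple.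
by case: eqVneq => // _ /andP[-> /le_trans ->].
Qed.

Let half_gt0 k : 0 < 2^-1 ^+ k :> R. Proof. by rewrite exprn_gt0. Qed.

Let half_le k l : (k <= l)%N -> 2^-1 ^+ l <= 2^-1 ^+ k :> R.
Proof. by move=> kl; apply: ler_wiXn2l => //; rewrite invf_le1// ler1n. Qed.

Let half_cvg : 2^-1 ^+ k @[k --> \oo] --> (0 : R).
Proof. by apply: cvg_expr; rewrite ger0_norm ?invr_ge0// invf_lt1// ltr1n. Qed.

Lemma distribution_right_continuous x j :
  distribution (upd x j r) @[r --> (tnth x j : R)^'+] --> distribution x.
Proof.
rewrite -[X in _ --> distribution X](upd_id x j).
apply: (@nondecreasing_cvg_right _ (fun r => distribution (upd x j r)) _
  (fun k => tnth x j + 2^-1 ^+ k)) => [|k|].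
- exact: distribution_upd_homo.
- by rewrite ltrDl.
pose G i k : set T := [set t | 0 <= tnth t i <= (if i == j then
  (if k is Some k then tnth x j + 2^-1 ^+ k else tnth x j) else tnth x i)].
have boxE k : box G (set_level (fun=> None) j k) =
    rect origin (upd x j (if k is Some k then tnth x j + 2^-1 ^+ k else tnth x j)).
  apply/seteqP; split=> t; [move=> h; apply/rect0P => i|move=> /rect0P h i];
    by have := h i; rewrite /G /set_level/= tnth_mktuple; case: eqVneq.
have := @box_cvg_decreasing _ _ _ P m G _ j _ _ (fun=> None) erefl.
have boxN : box G (fun=> None) = rect origin (upd x j (tnth x j)).
  by rewrite -(boxE None); congr box; exact/esym/(set_level_id (fun=> None) j).
rewrite boxN => h; under eq_fun do rewrite /distribution -(boxE (Some _)).
apply: h => [i k|k l kl|].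
- have := @measurable_coord_preimage R m i _ (measurable_itv `[0, (if i == j then
    (if k is Some k then tnth x j + 2^-1 ^+ k else tnth x j) else tnth x i)]).
  by under eq_set do rewrite /= in_itv/=.
- rewrite subsetEset => t; rewrite /G/= eqxx => /andP[-> /le_trans]; apply.
  by rewrite lerD2l half_le.
- apply/seteqP; split => t; rewrite /G/= eqxx.
    move=> h; have /= /andP[-> _]/= := h 0%N I.
    apply/ler_addgt0Pr => e e0; have /cvgrPdist_lt/(_ e e0)[k _ /(_ k (leqnn k))] := half_cvg.
    rewrite /= sub0r normrN (ger0_norm (ltW (half_gt0 k))) => ke.
    by have /= /andP[_ tk] := h k I; rewrite (le_trans tk)// lerD2l ltW.
  by move=> /andP[t0 tx] k _ /=; rewrite t0 (le_trans tx)// lerDl ltW.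
Qed.

(** Continuity from below only reaches the points with [t_j < 1]; the remaining slice [t_j = 1] lies
    outside [hcube] and is null. *)
Lemma distribution_left_continuous_at1 x j :
  (forall A : set T, measurable A -> A `&` hcube = set0 -> P A = 0%E) -> tnth x j = 1 ->
  distribution (upd x j r) @[r --> (tnth x j : R)^'-] --> distribution x.
Proof.
move=> P0 xj; rewrite -[X in _ --> distribution X](upd_id x j).
apply: (@nondecreasing_cvg_left _ (fun r => distribution (upd x j r)) _
  (fun k => tnth x j - 2^-1 ^+ k)) => [|k|].
- exact: distribution_upd_homo.
- by rewrite ltrBlDr ltrDl.
pose G i k : set T := [set t | if i == j then
  (if k is Some k then 0 <= tnth t j <= tnth x j - 2^-1 ^+ k else 0 <= tnth t j < 1)
  else 0 <= tnth t i <= tnth x i].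
have mG i k : measurable (G i k).
  rewrite /G; case: eqVneq => [_|_].
    case: k => [k|].
      have := @measurable_coord_preimage R m j _ (measurable_itv `[0, tnth x j - 2^-1 ^+ k]).
      by under eq_set do rewrite /= in_itv/=.
    have := @measurable_coord_preimage R m j _ (measurable_itv `[0, 1[).
    by under eq_set do rewrite /= in_itv/=.
  have := @measurable_coord_preimage R m i _ (measurable_itv `[0, tnth x i]).
  by under eq_set do rewrite /= in_itv/=.
have boxE k : box G (set_level (fun=> None) j (Some k)) =
    rect origin (upd x j (tnth x j - 2^-1 ^+ k)).
  apply/seteqP; split=> t; [move=> h; apply/rect0P => i|move=> /rect0P h i];
    by have := h i; rewrite /G /set_level/= tnth_mktuple; case: eqVneq => [->|].
have boxN : P (box G (fun=> None)) = P (rect origin (upd x j (tnth x j))).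
  rewrite (finite_measure_hcube P0); last exact: measurable_box.
  rewrite [in RHS](finite_measure_hcube P0); last exact: measurable_rect.
  congr (P _); rewrite upd_id; apply/seteqP; split=> t [ht th]; split => //.
    apply/rect0P => i; have := ht i; rewrite /G/=; case: eqVneq => // ->.
    by rewrite xj => /andP[-> /ltW].
  by move=> i; have /rect0P/(_ i) := ht; rewrite /G/=; case: eqVneq => // ->; have := th j.
have := @box_cvg_increasing _ _ _ P m G mG j _ _ (fun=> None) erefl.
rewrite boxN => h; under eq_fun do rewrite /distribution -boxE.
apply: h => [k l kl|].
  rewrite subsetEset => t; rewrite /G/= eqxx => /andP[-> /le_trans]; apply.
  by rewrite lerD2l lerN2 half_le.
apply/seteqP; split => t; rewrite /G/= eqxx.
  move=> [k _] /=; rewrite xj => /andP[-> h]/=; apply: le_lt_trans h _.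
  by rewrite ltrBlDr ltrDl.
move=> /andP[t0 t1].
have /cvgrPdist_lt/(_ (1 - tnth t j)) := half_cvg; rewrite subr_gt0 => /(_ t1).
move=> [k _ /(_ k (leqnn k))]; rewrite /= sub0r normrN (ger0_norm (ltW (half_gt0 k))) => hk.
by exists k => //=; rewrite t0/= xj; lra.
Qed.

End distribution_function.

Lemma integrable_lincomb d (T : measurableType d) (R : realType)
    (mu : {measure set T -> \bar R}) (D : set T) (I : Type) (r : seq I) (c : I -> R)
    (f : I -> T -> R) : measurable D ->
  (forall i, mu.-integrable D (EFin \o f i)) ->
  mu.-integrable D (EFin \o (fun t => \sum_(i <- r) c i * f i t)).
Proof.
move=> mD intf.
have -> : EFin \o (fun t => \sum_(i <- r) c i * f i t) =
    (fun t => \sum_(i <- r) (c i)%:E * (EFin \o f i) t)%E.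
  by apply/funext => t /=; rewrite -sumEFin; apply: eq_bigr => i _; rewrite EFinM.
by apply: integrable_sum => // i _; exact: integrableZl.
Qed.

Lemma Rintegral_lincomb d (T : measurableType d) (R : realType)
    (mu : {measure set T -> \bar R}) (D : set T) (I : Type) (r : seq I) (c : I -> R)
    (f : I -> T -> R) : measurable D ->
  (forall i, mu.-integrable D (EFin \o f i)) ->
  \int[mu]_(t in D) (\sum_(i <- r) c i * f i t) =
  \sum_(i <- r) c i * \int[mu]_(t in D) f i t.
Proof.
move=> mD intf; elim: r => [|i r IH].
  rewrite big_nil; under eq_Rintegral do rewrite big_nil.
  by rewrite Rintegral_cst// mul0r.
have intcf : mu.-integrable D (EFin \o (fun t => c i * f i t)).
  have -> : EFin \o (fun t => c i * f i t) = (fun t => (c i)%:E * (EFin \o f i) t)%E.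
    by apply/funext => t /=; rewrite EFinM.
  exact: integrableZl.
rewrite big_cons -IH -RintegralZl// -RintegralD//; last exact: integrable_lincomb.
by apply: eq_Rintegral => t _; rewrite big_cons.
Qed.

Lemma Rintegral_indic d (T : measurableType d) (R : realType)
    (mu : {measure set T -> \bar R}) (A : set T) : measurable A ->
  \int[mu]_t (\1_A t : R) = fine (mu A).
Proof. by move=> mA; rewrite /Rintegral integral_indic// setIT. Qed.

(** Integrating a pointwise identity between indicators turns inclusion-exclusion into an identity
    between masses. *)
Lemma finite_measure_lincomb d (T : measurableType d) (R : realType)
    (P : {finite_measure set T -> \bar R}) (I : Type) (r : seq I) (c : I -> R)
    (A : I -> set T) (C : set T) : (forall i, measurable (A i)) -> measurable C ->
  (forall t, \sum_(i <- r) c i * \1_(A i) t = \1_C t) ->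
  \sum_(i <- r) c i * fine (P (A i)) = fine (P C).
Proof.
move=> mA mC E; rewrite -(Rintegral_indic P mC).
under [RHS]eq_Rintegral do rewrite -E.
rewrite Rintegral_lincomb//; first by apply: eq_bigr => i _; rewrite Rintegral_indic.
by move=> i; exact: integrable_indic.
Qed.

Lemma prodr_bool (R : realType) (I : finType) (Q p : pred I) :
  \prod_(i | Q i) (p i)%:R = [forall (i | Q i), p i]%:R :> R.
Proof.
have [/forallP h|/forallPn[i]] := boolP [forall (i | Q i), p i].
  by rewrite big1// => i Qi; have := h i; rewrite Qi/= => ->.
by rewrite negb_imply => /andP[Qi pi]; rewrite (bigD1 i)//= (negbTE pi) mul0r.
Qed.

(** * Variation of a distribution function, face by face *)

Section vitali_upper_bound.
Context {R : realType} {m : nat}.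
Local Notation T := (m.-tuple (measurableTypeR R)).
Local Notation origin := (Defs.tuple0 m : m.-tuple R).

(** Inclusion-exclusion over closed rectangles anchored at the origin leaves cells open on the left;
    this also makes the cells of a split disjoint. *)
Definition face_cell (B : {set 'I_m}) (u v : #|B|.-tuple R) : set T :=
  [set t | forall j, if j \in B then tnth (face u) j < tnth t j <= tnth (face v) j
                     else tnth t j == 0].

Lemma measurable_face_cell (B : {set 'I_m}) (u v : #|B|.-tuple R) :
  measurable (face_cell u v).
Proof.
apply: measurable_forall_ord => j; case: (j \in B).
  have := @measurable_coord_preimage R m j _ (measurable_itv `]tnth (face u) j, tnth (face v) j]).
  by under eq_set do rewrite /= in_itv/=.
have := @measurable_coord_preimage R m j _ (measurable_set1 (0 : R)).
by congr measurable; apply/seteqP; split => t /= /eqP.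
Qed.

Lemma indic_rect (z : m.-tuple R) (t : T) :
  \1_(rect origin z) t = prodf (fun j r => (0 <= tnth t j <= r)%R%:R) z :> R.
Proof.
rewrite /prodf (prodr_bool _ xpredT (fun j => 0 <= tnth t j <= tnth z j)) indicE; congr (nat_of_bool _)%:R.
by apply/idP/forallP => [/set_mem/rect0P h j|h]; [exact: h|rewrite inE; apply/rect0P => j; exact: h].
Qed.

(** For fixed [t] the indicator of a rectangle is a product in its upper corner, so the quasi-volume
    factors: each coordinate in [B] yields the indicator of a half-open interval, each other one
    that of [t_j = 0]. *)
Lemma quasi_volume_distribution (P : {finite_measure set T -> \bar R})
    (B : {set 'I_m}) (u v : #|B|.-tuple R) :
  (forall i, 0 <= tnth u i <= tnth v i) ->
  quasi_volume (fun y => distribution P (face y)) u v = fine (P (face_cell u v)).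
Proof.
move=> uv; apply: finite_measure_lincomb.
- by move=> D; exact: measurable_rect.
- exact: measurable_face_cell.
move=> t; rewrite -[LHS]/(quasi_volume (fun y => \1_(rect origin (face y)) t) u v).
set psi := fun (j : 'I_m) (r : R) => (0 <= tnth t j <= r)%R%:R : R.
rewrite (@eq_quasi_volume _ _ _ (fun y => (\prod_(j | j \notin B) psi j 0) *
  prodf (fun i => psi (enum_val i)) y)); last first.
  by move=> y _; rewrite indic_rect prodf_face.
rewrite quasi_volumeZ quasi_volume_prod.
under [X in _ * X]eq_bigr => i _ do rewrite -!tnth_face_val.
rewrite -(big_enum_val (fun j => psi j (tnth (face v) j) - psi j (tnth (face u) j)))/=.
have -> : \prod_(j in B) (psi j (tnth (face v) j) - psi j (tnth (face u) j)) =
    \prod_(j in B) (tnth (face u) j < tnth t j <= tnth (face v) j)%R%:R.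
  apply: eq_bigr => j jB; rewrite /psi.
  have := uv (enum_rank_in jB j); rewrite -!tnth_face_val enum_rankK_in// => /andP[u0 uv'].
  case: (ltP (tnth (face u) j) (tnth t j)) => h1.
    by rewrite (le_trans u0 (ltW h1))/= subr0.
  by rewrite (le_trans h1 uv') andbT subrr.
have -> : \prod_(j | j \notin B) psi j 0 = \prod_(j | j \notin B) (tnth t j == 0)%R%:R.
  by apply: eq_bigr => j _; rewrite /psi eq_le andbC.
rewrite !prodr_bool indicE -natrM mulnb; congr (nat_of_bool _)%:R.
apply/esym; apply/idP/idP => [/set_mem h|/andP[/forallP h1 /forallP h2]].
  by apply/andP; split; apply/forallP => j; apply/implyP => jB; have := h j;
    rewrite ?jB// (negbTE jB).
by rewrite inE => j; have := h1 j; have := h2 j; case: (j \in B).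
Qed.

(** Strict positivity on [B] makes these sets disjoint for distinct [B] and keeps the origin out
    when [B] is nonempty. The variations of the faces can thus be charged to a single mass of the
    cube without the origin. *)
Definition face_support (B : {set 'I_m}) : set T :=
  [set t | forall j, if j \in B then 0 < tnth t j else tnth t j == 0].

Lemma measurable_face_support B : measurable (face_support B).
Proof.
apply: measurable_forall_ord => j; case: (j \in B).
  have := @measurable_coord_preimage R m j _ (measurable_itv `]0, +oo[).
  by under eq_set do rewrite /= in_itv/= andbT.
have := @measurable_coord_preimage R m j _ (measurable_set1 (0 : R)).
by congr measurable; apply/seteqP; split => t /= /eqP.
Qed.

Lemma split_points (p : seq R) l : itv_partition 0 1 p -> (l < size p)%N ->
  0 <= nth 0 (0 :: p) l <= nth 0 (0 :: p) l.+1 /\ nth 0 (0 :: p) l.+1 <= 1.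
Proof.
move=> [sp /eqP lp] lS.
have nE i j : (i <= size p)%N -> (j <= size p)%N ->
    (nth 0 (0 :: p) i <= nth 0 (0 :: p) j) = (i <= j)%N.
  by move=> ip jp; rewrite lt_sorted_leq_nth.
have n1 : nth 0 (0 :: p) (size p) = 1 by rewrite -lp (last_nth 0).
have s0 : nth 0 (0 :: p) 0 <= nth 0 (0 :: p) l by rewrite nE// ltnW.
have sl : nth 0 (0 :: p) l <= nth 0 (0 :: p) l.+1 by rewrite nE// ltnW.
have s1 : nth 0 (0 :: p) l.+1 <= nth 0 (0 :: p) (size p) by rewrite nE.
by rewrite n1 in s1; split => //; apply/andP.
Qed.

Lemma face_cell_disjoint (B : {set 'I_m}) (p : 'I_#|B| -> seq R)
    (l l' : {dffun forall k : 'I_#|B|, 'I_(size (p k))}) : is_split p -> l != l' ->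
  face_cell [tuple nth 0 (0 :: p k) (l k) | k < #|B|]
            [tuple nth 0 (0 :: p k) (l k).+1 | k < #|B|] `&`
  face_cell [tuple nth 0 (0 :: p k) (l' k) | k < #|B|]
            [tuple nth 0 (0 :: p k) (l' k).+1 | k < #|B|] = set0.
Proof.
move=> sp ll'; rewrite -subset0 => t [h h'].
have /existsP[k lk] : [exists k, l k != l' k].
  apply: contraNT ll'; rewrite negb_exists => /forallP e.
  by apply/eqP/ffunP => k; apply/eqP; rewrite -[_ == _]negbK e.
have := h (enum_val k); have := h' (enum_val k); rewrite enum_valP !tnth_face_val !tnth_mktuple.
have [srt _] := sp k.
have nE i j : (i <= size (p k))%N -> (j <= size (p k))%N ->
    (nth 0 (0 :: p k) i < nth 0 (0 :: p k) j) = (i < j)%N.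
  by move=> ip jp; rewrite lt_sorted_ltn_nth.
move=> /andP[a1 a2] /andP[b1 b2].
have := lt_le_trans a1 b2; have := lt_le_trans b1 a2.
rewrite !nE ?ltnS//; try by rewrite ltnW.
move=> e1 e2; move/negP: lk; apply; apply/eqP/val_inj/eqP.
by rewrite eqn_leq e1 e2.
Qed.

Lemma quasi_volumeB n (f g : n.-tuple R -> R) u v :
  quasi_volume (fun x => f x - g x) u v = quasi_volume f u v - quasi_volume g u v.
Proof. by rewrite /quasi_volume -sumrB; apply: eq_bigr => D _; rewrite mulrBr. Qed.

(** Each quasi-volume is a difference of two masses of a cell, hence at most their sum in absolute
    value; the cells of a split are disjoint and lie in the support of the face. *)
Lemma face_vitali_le (g : m.-tuple R -> R) (P N : {finite_measure set T -> \bar R})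
    (B : {set 'I_m}) :
  (forall x, cube x -> g x = distribution P x - distribution N x) ->
  (vitali (fun y => g (@face R m B y)) <= P (face_support B) + N (face_support B))%E.
Proof.
move=> gE; apply: ge_ereal_sup => _ [p sp <-].
set u := fun l : {dffun forall k : 'I_#|B|, 'I_(size (p k))} =>
  [tuple nth 0 (0 :: p k) (l k) | k < #|B|].
set v := fun l : {dffun forall k : 'I_#|B|, 'I_(size (p k))} =>
  [tuple nth 0 (0 :: p k) (l k).+1 | k < #|B|].
rewrite -[X in (X%:E <= _)%E]/(\sum_l `|quasi_volume (fun y => g (face y)) (u l) (v l)|).
have uv l i : 0 <= tnth (u l) i <= tnth (v l) i /\ tnth (v l) i <= 1.
  by rewrite !tnth_mktuple; apply: split_points; [exact: sp|exact: ltn_ord].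
have le_cells (Q : {finite_measure set T -> \bar R}) :
    ((\sum_l fine (Q (face_cell (u l) (v l))))%:E <= Q (face_support B))%E.
  rewrite -sumEFin.
  rewrite (eq_bigr (fun l => Q (face_cell (u l) (v l)))); last first.
    by move=> l _; rewrite fineK// fin_num_measure//; exact: measurable_face_cell.
  rewrite -measure_big_setU; last 2 first.
  - by move=> l; exact: measurable_face_cell.
  - by move=> l l' _ _; exact: face_cell_disjoint.
  apply: le_measure; rewrite ?inE.
  - by apply: bigsetU_measurable => l _; exact: measurable_face_cell.
  - exact: measurable_face_support.
  elim/big_rec: _ => // l A _ IH t [h j|/IH//]; have := h j.
  case: ifP => // jB /andP[+ _]; apply: le_lt_trans.
  rewrite -(enum_rankK_in jB jB) tnth_face_val.
  by have [/andP[]] := uv l (enum_rank_in jB j).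
apply: le_trans (leeD (le_cells P) (le_cells N)).
rewrite -EFinD lee_fin -big_split/=; apply: ler_sum => l _.
rewrite (@eq_quasi_volume _ _ _ (fun y => distribution P (face y) - distribution N (face y))).
  rewrite quasi_volumeB !quasi_volume_distribution; try by move=> i; have [] := uv l i.
  by apply: le_trans (ler_normB _ _) _; rewrite !ger0_norm ?fine_ge0.
move=> y hy; apply/gE/cube_face/cubeP => i; have [/andP[h1 h2] h3] := uv l i.
by case: (hy i) => ->; apply/andP; split=> //; [exact: le_trans h3|exact: le_trans h2].
Qed.

Lemma VHK0_le (g : m.-tuple R -> R) (P N : {finite_measure set T -> \bar R}) :
  (forall A : set T, measurable A -> A `&` hcube = set0 -> P A = 0%E) ->
  (forall A : set T, measurable A -> A `&` hcube = set0 -> N A = 0%E) ->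
  (forall x, cube x -> g x = distribution P x - distribution N x) ->
  (VHK0 g <= P (hcube `\ origin) + N (hcube `\ origin))%E.
Proof.
move=> P0 N0 gE.
apply: (@le_trans _ _ (\sum_(B : {set 'I_m} | (0 < #|B|)%N)
    (P (face_support B) + N (face_support B)))%E).
  by apply: lee_sum => B _; exact: face_vitali_le.
rewrite big_split/=.
have supp (Q : {finite_measure set T -> \bar R}) :
    (forall A : set T, measurable A -> A `&` hcube = set0 -> Q A = 0%E) ->
    (\sum_(B : {set 'I_m} | (0 < #|B|)%N) Q (face_support B) <= Q (hcube `\ origin))%E.
  move=> Q0; have mh := @measurable_hcube_punctured R m.
  have mo : measurable (~` [set origin] : set T).
    by apply: measurableC; exact: measurable_tuple1.
  have -> : hcube `\ origin = ~` [set origin] `&` hcube :> set T by rewrite setIC.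
  rewrite -(finite_measure_hcube Q0)// -measure_big_setU; last 2 first.
  - by move=> B; exact: measurable_face_support.
  - move=> B B' _ _ BB'; rewrite -subset0 => t [h h'].
    have /existsP[j jB] : [exists j, (j \in B) != (j \in B')].
      apply: contraNT BB'; rewrite negb_exists => /forallP e.
      by apply/eqP/finset.setP => j; apply/eqP; rewrite -[_ == _]negbK e.
    have := h j; have := h' j; move: jB.
    case: (j \in B); case: (j \in B') => // _; first by move=> /eqP ->; rewrite ltxx.
    by move=> tj /eqP tj0; move: tj; rewrite tj0 ltxx.
  apply: le_measure; rewrite ?inE//.
    by apply: bigsetU_measurable => B _; exact: measurable_face_support.
  elim/big_rec: _ => // B A B0 IH t [h /= tE|/IH//].
  have /card_gt0P[j jB] := B0; have := h j.
  by rewrite jB tE tnth_mktuple ltxx.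
by apply: leeD; exact: supp.
Qed.

End vitali_upper_bound.

(** * Integral representations *)

Section fubini.
Context {R : realType}.

Lemma rect_cons n (t0 x0 : R) (t x : n.-tuple R) :
  @cons_pair R n @^-1` rect [tuple of t0 :: t] [tuple of x0 :: x] =
  `[t0, x0]%classic `*` rect t x.
Proof.
apply/seteqP; split => [[s0 s]|[s0 s]] /=.
  move=> h; split; first by have := h ord0; rewrite /= in_itv.
  by move=> i; have := h (lift ord0 i); rewrite !tnthS.
rewrite in_itv/= => -[h0 h] i; case: (unliftP ord0 i) => [j ->|->]; last exact: h0.
by rewrite !tnthS.
Qed.

Lemma lebesgue_tuple_rect n (t x : n.-tuple R) :
  @lebesgue_tuple R n (rect t x) = (\prod_(i < n) Num.max (tnth x i - tnth t i) 0)%:E.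
Proof.
elim: n t x => [|n IH] t x.
  by rewrite big_ord0/= diracE mem_set// => -[].
case/tupleP: t => t0 t; case/tupleP: x => x0 x.
transitivity (lebesgue_measure `[t0, x0]%classic * @lebesgue_tuple R n (rect t x))%E.
  rewrite -[LHS]/((lebesgue_measure \x @lebesgue_tuple R n)%E
    (@cons_pair R n @^-1` rect [tuple of t0 :: t] [tuple of x0 :: x])).
  by rewrite rect_cons; apply: product_measure1E => //; exact: measurable_rect.
rewrite IH lebesgue_measure_itv/= big_ord_recl/= !tnth0 EFinM.
congr (_ * _)%E; last by congr EFin; apply: eq_bigr => i _; rewrite !tnthS.
rewrite lte_fin -EFinB /Num.max; have [h1|h1] := ltP t0 x0; congr EFin;
  have [h2|h2] := ltP (x0 - t0) 0; lra.
Qed.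

Variable m : nat.
Local Notation T := (m.-tuple (measurableTypeR R)).
Local Notation origin := (Defs.tuple0 m : m.-tuple R).
Local Notation lambda := (@lebesgue_tuple R m).

Variable P : {finite_measure set T -> \bar R}.
Hypothesis P_hcube : forall A : set T, measurable A -> A `&` hcube = set0 -> P A = 0%E.
Variable x : m.-tuple R.
Hypothesis cx : cube x.

(** The pairs with [t <= y <= x]: the section at [t] is a rectangle whose volume is the product of
    hinge functions, and the section at [y] has mass [distribution P y]. *)
Let E : set (T * T) := [set p | hcube p.1 /\
  forall i, tnth p.1 i <= tnth p.2 i /\ tnth p.2 i <= tnth x i].

Let measurable_E : measurable E.
Proof.
apply: measurableI.
  have := @measurable_fst _ _ T T measurableT _ (@measurable_hcube R m).
  by rewrite setTI.
apply: measurable_forall_ord => i.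
have m1 : measurable_fun setT (fun p : T * T => tnth p.1 i : measurableTypeR R).
  by apply: (measurableT_comp (@measurable_tnth _ _ m i)); exact: measurable_fst.
have m2 : measurable_fun setT (fun p : T * T => tnth p.2 i : measurableTypeR R).
  by apply: (measurableT_comp (@measurable_tnth _ _ m i)); exact: measurable_snd.
apply: measurableI.
  have := @measurable_fun_ler _ _ _ setT _ _ m1 m2 measurableT [set true] I.
  by rewrite setTI.
have := m2 measurableT _ (measurable_itv `]-oo, tnth x i]); rewrite setTI.
by congr measurable; apply/seteqP; split => t; rewrite /= in_itv.
Qed.

Let kernel (t : T) : R := \prod_(i < m) Num.max (tnth x i - tnth t i) 0.

Let xsectionE t : lambda (xsection E t) = ((fun t => (kernel t)%:E) \_ hcube) t.
Proof.
rewrite patchE; case: ifPn => [/set_mem th|/negP th].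
  rewrite -lebesgue_tuple_rect; congr (lambda _).
  apply/seteqP; split => y; rewrite /xsection/= inE.
    by move=> [_ h] i; have [-> ->] := h i.
  by move=> h; split => // i; have /andP[] := h i.
rewrite (_ : xsection E t = set0) ?measure0//.
rewrite -subset0 => y; rewrite /xsection/= inE => -[h _].
by apply: th; rewrite inE.
Qed.

Let ysectionE y : P (ysection E y) =
  ((fun y => (distribution P y)%:E) \_ (rect origin x)) y.
Proof.
rewrite patchE; case: ifPn => [/set_mem /rect0P yx|/negP yx].
  rewrite fineK ?fin_num_measure//; last exact: measurable_rect.
  rewrite [RHS](finite_measure_hcube P_hcube); last exact: measurable_rect.
  congr (P _); apply/seteqP; split => t; rewrite /ysection/= inE/=.
    move=> [ht h]; split => //; apply/rect0P => i; have [-> _] := h i.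
    by have /andP[->] := ht i.
  move=> [/rect0P h ht]; split => // i; have /andP[_ ->] := h i.
  by have /andP[] := yx i.
rewrite (_ : ysection E y = set0) ?measure0//.
rewrite -subset0 => t; rewrite /ysection/= inE/= => -[ht h].
apply: yx; rewrite inE; apply/rect0P => i; have [h1 ->] := h i.
by rewrite andbT; have /andP[t0 _] := ht i; exact: le_trans h1.
Qed.

Let fubini_eq : (\int[P]_(t in hcube) (kernel t)%:E =
  \int[lambda]_(y in rect origin x) (distribution P y)%:E)%E.
Proof.
rewrite [LHS]integral_mkcond [RHS]integral_mkcond.
under [LHS]eq_integral do rewrite -xsectionE.
under [RHS]eq_integral do rewrite -ysectionE.
(* The two iterated integrals are the masses of [E] under the product measures built from the two
   families of sections. These agree because both factor on measurable rectangles. *)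
have prodE A B : measurable A -> measurable B ->
    (P \x^ lambda)%E (A `*` B) = (P A * lambda B)%E by exact: product_measure2E.
exact: (@product_measure_unique _ _ _ _ _ P lambda (P \x^ lambda)%E prodE E measurable_E).
Qed.

Let kernel_ge0 t : 0 <= kernel t.
Proof. by rewrite prodr_ge0// => i _; rewrite le_max lexx orbT. Qed.

Let kernel_le1 t : hcube t -> kernel t <= 1.
Proof.
move=> th; apply: prodr_ile1 => i _; rewrite le_max lexx orbT/= ge_max ler01 andbT.
by have /andP[t0 _] := th i; have /cubeP/(_ i)/andP[_ x1] := cx; lra.
Qed.

Let measurable_kernel : measurable_fun (hcube : set T) (fun t : T => (kernel t)%:E).
Proof.
have := measurable_fun_xsection lambda measurable_E.
have -> : lambda \o xsection E = (fun t => (kernel t)%:E) \_ hcube.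
  by apply/funext => t; exact: xsectionE.
by move/(measurable_restrictT _ (@measurable_hcube R m)).
Qed.

Let kernel_lty : (\int[P]_(t in hcube) (kernel t)%:E < +oo)%E.
Proof.
have mh := @measurable_hcube R m.
apply: (@le_lt_trans _ _ (\int[P]_(t in hcube) 1%:E)%E).
  by apply: ge0_le_integral => // t th; rewrite lee_fin kernel_ge0.
by rewrite integral_cst// mul1e ltey_eq fin_num_measure.
Qed.

Lemma integrable_kernel : P.-integrable hcube
  (EFin \o (fun t : T => \prod_(i < m) Num.max (tnth x i - tnth t i) 0)).
Proof.
apply/integrableP; split; first exact: measurable_kernel.
by under eq_integral => t _ do rewrite /= ger0_norm ?kernel_ge0//; exact: kernel_lty.
Qed.

Lemma integrable_distribution :
  lambda.-integrable (rect origin x) (EFin \o distribution P).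
Proof.
have mr := @measurable_rect R m origin x.
have mG : measurable_fun [set: T]
    ((fun y : T => (distribution P y)%:E) \_ (rect origin x : set T)).
  have := measurable_fun_ysection P measurable_E.
  by congr measurable_fun; apply/funext => y; exact: ysectionE.
apply/integrableP; split; first exact/(measurable_restrictT _ mr).
under eq_integral => y _ do rewrite /= ger0_norm ?fine_ge0//.
by rewrite -fubini_eq kernel_lty.
Qed.

Lemma Rintegral_kernel : \int[P]_(t in hcube)
    (\prod_(i < m) Num.max (tnth x i - tnth t i) 0) =
  \int[lambda]_(y in rect origin x) distribution P y.
Proof. by rewrite /Rintegral -fubini_eq. Qed.

End fubini.

(** * Distribution functions of signed measures as densities *)

Section charge_densities.
Context {R : realType} {m : nat}.
Local Notation T := (m.-tuple (measurableTypeR R)).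
Local Notation origin := (Defs.tuple0 m : m.-tuple R).
Local Notation lambda := (@lebesgue_tuple R m).
Implicit Types nu : {charge set T -> \bar R}.

Definition charge_density nu (x : m.-tuple R) : R := fine (nu (rect origin x)).

Definition mars_kernel (x : m.-tuple R) (t : T) : R :=
  \prod_(i < m) Num.max (tnth x i - tnth t i) 0.

Let jp nu : {finite_measure set T -> \bar R} := jordan_pos (hahn_pair nu).
Let jn nu : {finite_measure set T -> \bar R} := jordan_neg (hahn_pair nu).

(** A Jordan part is, up to sign, [nu] of the intersection with a Hahn set, which still misses
    [hcube]. *)
Lemma jordan_carried nu : carried_by nu hcube -> forall A : set T, measurable A ->
  A `&` hcube = set0 ->
  jordan_pos (hahn_pair nu) A = 0%E /\ jordan_neg (hahn_pair nu) A = 0%E.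
Proof.
move=> carr A mA A0.
have [[mX _] [mY _] _ _] := hahn_pair nu.
have AX0 X : measurable X -> nu (A `&` X) = 0%E.
  by move=> mX'; apply: carr; [exact: measurableI|rewrite setIAC A0 set0I].
split.
  rewrite jordan_posE cjordan_posE.
  by rewrite /crestr0 mem_set// /crestr AX0.
rewrite jordan_negE cjordan_negE.
by rewrite /crestr0 mem_set// /crestr AX0// oppe0.
Qed.

Let jp_carried nu (h : carried_by nu hcube) (A : set T) (mA : measurable A)
  (A0 : A `&` hcube = set0) : jp nu A = 0%E := (jordan_carried h mA A0).1.
Let jn_carried nu (h : carried_by nu hcube) (A : set T) (mA : measurable A)
  (A0 : A `&` hcube = set0) : jn nu A = 0%E := (jordan_carried h mA A0).2.

Lemma charge_densityE nu x : charge_density nu x =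
  distribution (jordan_pos (hahn_pair nu)) x - distribution (jordan_neg (hahn_pair nu)) x.
Proof.
have mr := @measurable_rect R m origin x.
rewrite /charge_density jordan_decompE// fineB// fin_num_measure//.
Qed.

Lemma charge_density_right_continuous nu : coord_right_continuous (charge_density nu).
Proof.
move=> x cx j xj; under eq_fun do rewrite charge_densityE; rewrite charge_densityE.
by apply: cvgB; exact: distribution_right_continuous.
Qed.

Lemma charge_density_left_continuous_at1 nu : carried_by nu hcube ->
  coord_left_continuous_at1 (charge_density nu).
Proof.
move=> carr x cx j xj; under eq_fun do rewrite charge_densityE; rewrite charge_densityE.
by apply: cvgB; apply: distribution_left_continuous_at1 => //;
  [exact: jp_carried|exact: jn_carried].
Qed.

Lemma VHK0_le_total_variation (nu : {charge set T -> \bar R}) (g : m.-tuple R -> R) : carried_by nu hcube ->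
  (forall x, cube x -> g x = charge_density nu x) ->
  (VHK0 g <= Defs.total_variation nu (hcube `\ origin))%E.
Proof.
move=> carr gE; apply: (@VHK0_le _ _ g (jp nu) (jn nu)).
- exact: jp_carried.
- exact: jn_carried.
- by move=> x cx; rewrite gE// charge_densityE.
Qed.

Lemma total_variation_lty nu A : measurable A -> (Defs.total_variation nu A < +oo)%E.
Proof.
move=> mA; rewrite -[X in (X < _)%E]/(jp nu A + jn nu A)%E.
by rewrite ltey_eq fin_numD !fin_num_measure.
Qed.

Lemma density_charge_ex (g : m.-tuple R -> R) : (VHK0 g < +oo)%E -> coord_right_continuous g ->
    coord_left_continuous_at1 g ->
  exists2 nu : {charge set T -> \bar R}, carried_by nu hcube & forall x, cube x -> charge_density nu x = g x.
Proof.
move=> gV rc lc; have [P [N [PN0 PN _]]] := density_charge gV rc lc.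
have [nu nuE] := finite_charge_ex P N; exists nu.
  by move=> A mA A0; rewrite nuE; have [-> ->] := PN0 A A0; rewrite sube0.
move=> x cx; rewrite /charge_density nuE fineB ?PN//; apply: fin_num_measure;
  exact: measurable_rect.
Qed.

(** One inequality comes from cells. For the other, the [P] and [N] built from [g] have the
    distribution function of [nu], so [nu = P - N] by uniqueness; minimality of the Jordan
    decomposition gives [|nu| <= P + N], whose mass off the origin is at most [VHK0 g]. *)
Lemma VHK0_total_variation (nu : {charge set T -> \bar R}) (g : m.-tuple R -> R) : carried_by nu hcube ->
  (VHK0 g < +oo)%E -> coord_right_continuous g -> coord_left_continuous_at1 g ->
  (forall x, cube x -> g x = charge_density nu x) ->
  VHK0 g = Defs.total_variation nu (hcube `\ origin).
Proof.
move=> carr gV rc lc gE; apply/eqP; rewrite eq_le VHK0_le_total_variation//=.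
have [P [N [PN0 PN PNle]]] := density_charge gV rc lc.
apply: le_trans PNle; apply: total_variation_le; last exact: measurable_hcube_punctured.
move=> B mB; rewrite jordan_decompE//.
apply: (@rect_charge_unique R m (jp nu) (jn nu) P N) => //.
  move=> Q [[->|->]|[->|->]] A mA A0; first exact: jp_carried.
  - exact: jn_carried.
  - by have [] := PN0 A A0.
  - by have [] := PN0 A A0.
by move=> x cx; rewrite PN// gE// charge_densityE.
Qed.

Lemma charge_integral_kernel (nu : {charge set T -> \bar R}) (g : m.-tuple R -> R)
    (x : m.-tuple R) : carried_by nu hcube -> cube x ->
  (forall y, cube y -> g y = charge_density nu y) ->
  charge_integral nu hcube (mars_kernel x) = \int[lambda]_(y in rect origin x) g y.
Proof.
move=> carr cx gE; rewrite /charge_integral.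
rewrite (Rintegral_kernel (jp_carried carr)) (Rintegral_kernel (jn_carried carr)).
rewrite -RintegralB//; last 3 first.
- exact: measurable_rect.
- exact: (integrable_distribution (jp_carried carr)).
- exact: (integrable_distribution (jn_carried carr)).
apply: eq_Rintegral => y /set_mem /rect0P yx; rewrite gE ?charge_densityE//.
apply/cubeP => i; have /andP[-> yi] := yx i; apply: le_trans yi _.
by have /cubeP/(_ i)/andP[] := cx.
Qed.

End charge_densities.

(** * Recovering a signed measure from its hinge integrals *)

Section uniqueness.
Context {R : realType} {m : nat}.
Local Notation T := (m.-tuple (measurableTypeR R)).
Local Notation origin := (Defs.tuple0 m : m.-tuple R).

Let half_gt0 k : 0 < 2^-1 ^+ k :> R. Proof. by rewrite exprn_gt0. Qed.

Let half_le1 k : 2^-1 ^+ k <= 1 :> R.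
Proof. by rewrite exprn_ile1// invf_le1// ler1n. Qed.

Let half_lt (e : R) : 0 < e -> exists k, forall l, (k <= l)%N -> 2^-1 ^+ l < e.
Proof.
move=> e0; have : 2^-1 ^+ k @[k --> \oo] --> (0 : R).
  by apply: cvg_expr; rewrite ger0_norm ?invr_ge0// invf_lt1// ltr1n.
move=> /cvgrPdist_lt/(_ e e0)[k _ h]; exists k => l kl; have := h l kl.
by rewrite /= sub0r normrN (ger0_norm (ltW (half_gt0 l))).
Qed.

(* Ends of an interval on which the difference quotient of [x |-> (x - t)_+]
   is taken to approximate the indicator of [t <= c]; at [c = 1] the interval
   has to lie to the left of [c], and the limit is the indicator of [t < 1]. *)
Let hi k (c : R) : R := if c < 1 then c + (1 - c) * 2^-1 ^+ k else 1.
Let lo k (c : R) : R := if c < 1 then c else 1 - 2^-1 ^+ k.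

(** The factor [1 - c] in [hi] keeps both ends in [[0, 1]]: hinge integrals are compared at points
    of the cube only. *)
Let lo_hi k c : 0 <= c <= 1 -> [/\ 0 <= lo k c, lo k c < hi k c & hi k c <= 1].
Proof.
move=> /andP[c0 c1]; rewrite /lo /hi; have h0 := half_gt0 k; have h1 := half_le1 k.
have [c1'|c1'] := ltP c 1; last by split; lra.
have p : 0 < (1 - c) * 2^-1 ^+ k by rewrite mulr_gt0// subr_gt0.
have p' : (1 - c) * 2^-1 ^+ k <= 1 - c by rewrite ler_piMr// subr_ge0.
by split; lra.
Qed.

Let quot k c t : R :=
  (Num.max (hi k c - t) 0 - Num.max (lo k c - t) 0) / (hi k c - lo k c).

Let quot01 k c t : 0 <= c <= 1 -> 0 <= quot k c t <= 1.
Proof.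
move=> c01; have [_ lh _] := lo_hi k c01.
have d0 : 0 < hi k c - lo k c by rewrite subr_gt0.
rewrite /quot ler_pdivrMr// mul1r /Num.max.
have [h1|h1] := ltP (hi k c - t) 0; have [h2|h2] := ltP (lo k c - t) 0;
  apply/andP; split; rewrite ?divr_ge0//; lra.
Qed.

(** The quotient is exactly 1 to the left of [lo] and exactly 0 to the right of [hi], so at each
    [t < 1] it is eventually equal to its limit. *)
Let quot_cvg c t : 0 <= c <= 1 -> t < 1 -> quot k c t @[k --> \oo] --> ((t <= c)%R%:R : R).
Proof.
move=> c01 t1; have /andP[c0 c1] := c01.
have [K HK] : exists K, forall k, (K <= k)%N -> quot k c t = (t <= c)%R%:R; last first.
  apply: cvg_near_cst; exists K => // k /= Kk; exact: HK.
have quot1 k : t <= lo k c -> quot k c t = 1.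
  move=> tl; have [_ lh _] := lo_hi k c01.
  have -> : 1 = (hi k c - lo k c) / (hi k c - lo k c).
    by rewrite divff// subr_eq0 gt_eqF.
  rewrite /quot /Num.max; congr (_ / _).
  have [h1|h1] := ltP (hi k c - t) 0; have [h2|h2] := ltP (lo k c - t) 0; lra.
have quot0 k : hi k c <= t -> quot k c t = 0.
  move=> ht; have [_ lh _] := lo_hi k c01.
  rewrite /quot /Num.max.
  have [h1|h1] := ltP (hi k c - t) 0; have [h2|h2] := ltP (lo k c - t) 0;
    rewrite ?subrr ?mul0r//; try by lra.
  by rewrite (_ : hi k c - t - 0 = 0) ?mul0r//; lra.
have [c1'|c1'] := ltP c 1.
  have [tc|tc] := leP t c.
    by exists 0%N => k _; rewrite quot1// /lo c1'.
  have [K HK] := @half_lt (t - c) ltac:(by rewrite subr_gt0).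
  exists K => k /HK hk; rewrite quot0// /hi c1'.
  have p' : (1 - c) * 2^-1 ^+ k <= 2^-1 ^+ k.
    by apply: ler_piMl; [exact: ltW|lra].
  lra.
have tc : t <= c by rewrite (le_trans (ltW t1)).
have [K HK] := @half_lt (1 - t) ltac:(by rewrite subr_gt0).
by exists K => k /HK hk; rewrite tc quot1// /lo ltNge c1'/=; lra.
Qed.

Let low k (c : m.-tuple R) : m.-tuple R := [tuple lo k (tnth c i) | i < m].
Let high k (c : m.-tuple R) : m.-tuple R := [tuple hi k (tnth c i) | i < m].
Let scale k (c : m.-tuple R) : R := \prod_(i < m) (hi k (tnth c i) - lo k (tnth c i))^-1.

Let corner_cube k c x : cube c ->
  (forall i, tnth x i = tnth (low k c) i \/ tnth x i = tnth (high k c) i) -> cube x.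
Proof.
move=> /cubeP cc h; apply/cubeP => i.
have [l0 lh h1] := lo_hi k (cc i).
by case: (h i) => ->; rewrite tnth_mktuple; apply/andP; split => //; lra.
Qed.

(** The scaled quasi-volume passes under the integral and factors on the kernel into a product of
    difference quotients. These lie in [[0, 1]] and [P] is finite, so dominated convergence
    applies. *)
Lemma kernel_quotient_cvg (P : {finite_measure set T -> \bar R}) (c : m.-tuple R) :
  (forall A : set T, measurable A -> A `&` hcube = set0 -> P A = 0%E) -> cube c ->
  scale k c * quasi_volume (fun x => \int[P]_(t in hcube) mars_kernel x t)
    (low k c) (high k c) @[k --> \oo] --> distribution P c.
Proof.
move=> P0 cc; have mh := @measurable_hcube R m.
have cc' i : 0 <= tnth c i <= 1 by have /cubeP := cc.
pose q k (t : T) : R := \prod_(i < m) quot k (tnth c i) (tnth t i).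
have qE k t : q k t = \sum_(D : {set 'I_m}) scale k c * (-1) ^+ #|D| *
    mars_kernel [tuple tnth (high k c) i + (i \in D)%:R *
      (tnth (low k c) i - tnth (high k c) i) | i < m] t.
  under eq_bigr do rewrite -mulrA.
  rewrite -mulr_sumr -[X in _ * X]/(quasi_volume (fun x => mars_kernel x t) (low k c) (high k c)).
  rewrite -[X in quasi_volume X]/(prodf (fun i r => Num.max (r - tnth t i) 0)).
  rewrite quasi_volume_prod mulrC -big_split/=; apply: eq_bigr => i _.
  by rewrite !tnth_mktuple.
have int_kernel k (D : {set 'I_m}) : P.-integrable hcube (EFin \o mars_kernel
    [tuple tnth (high k c) i + (i \in D)%:R *
      (tnth (low k c) i - tnth (high k c) i) | i < m]).
  apply: integrable_kernel; apply: (@corner_cube k c) => // i; rewrite !tnth_mktuple.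
  by case: (i \in D); [left; rewrite mul1r addrC subrK|right; rewrite mul0r addr0].
have int_q k : P.-integrable hcube (EFin \o q k).
  have -> : EFin \o q k = EFin \o (fun t => \sum_(D : {set 'I_m}) scale k c * (-1) ^+ #|D| *
    mars_kernel [tuple tnth (high k c) i + (i \in D)%:R *
      (tnth (low k c) i - tnth (high k c) i) | i < m] t).
    by apply/funext => t /=; rewrite qE.
  exact: integrable_lincomb.
have -> : (fun k => scale k c * quasi_volume (fun x => \int[P]_(t in hcube) mars_kernel x t)
    (low k c) (high k c)) = (fun k => \int[P]_(t in hcube) q k t).
  apply/funext => k; under [RHS]eq_Rintegral do rewrite qE.
  by rewrite Rintegral_lincomb// mulr_sumr; apply: eq_bigr => D _; rewrite mulrA.
pose ind (t : T) : R := \prod_(i < m) (tnth t i <= tnth c i)%R%:R.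
have mr := @measurable_rect R m origin c.
have indE : (\int[P]_(t in hcube) (ind t)%:E = P (rect origin c))%E.
  rewrite (finite_measure_hcube P0)// -integral_indic//.
  apply: eq_integral => t /set_mem th; congr EFin.
  rewrite /ind (prodr_bool _ xpredT (fun i => tnth t i <= tnth c i)) indicE.
  congr (nat_of_bool _)%:R; apply/esym; apply/idP/forallP => [/set_mem/rect0P h i|h].
    by have /andP[] := h i.
  by rewrite inE; apply/rect0P => i; have /andP[-> _] := th i; exact: h.
have cvg_int : (\int[P]_(t in hcube) (q k t)%:E @[k --> \oo] -->
    \int[P]_(t in hcube) (ind t)%:E)%E.
  apply: (@dominated_cvg _ _ _ P hcube mh _ _ (cst 1%E)).
  - by move=> k; have /integrableP[] := int_q k.
  - move=> t th; apply/cvg_EFin; first exact: nearW.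
    apply: (@cvg_big R^o) => [|i _]; first exact: mul_continuous.
    by apply: quot_cvg => //; have /andP[] := th i.
  - by [].
  - exact: finite_measure_integrable_cst.
  - move=> k t th; rewrite lee_fin ger0_norm.
      by apply: prodr_ile1 => i _; exact: quot01.
    by apply: prodr_ge0 => i _; have /andP[] := quot01 k (tnth t i) (cc' i).
apply: fine_cvg; rewrite fineK ?fin_num_measure//.
by rewrite -indE.
Qed.

Lemma charge_density_unique (nu nu' : {charge set T -> \bar R}) :
  carried_by nu hcube -> carried_by nu' hcube ->
  (forall x, cube x ->
    charge_integral nu hcube (mars_kernel x) = charge_integral nu' hcube (mars_kernel x)) ->
  forall x, cube x -> charge_density nu x = charge_density nu' x.
Proof.
move=> cnu cnu' E c cc.
have lim (mu : {charge set T -> \bar R}) : carried_by mu hcube ->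
    scale k c * quasi_volume (fun x => charge_integral mu hcube (mars_kernel x))
      (low k c) (high k c) @[k --> \oo] --> charge_density mu c.
  move=> cmu; rewrite charge_densityE.
  rewrite (_ : (fun k => _) = (fun k => scale k c * quasi_volume (fun x =>
      \int[jordan_pos (hahn_pair mu)]_(t in hcube) mars_kernel x t) (low k c) (high k c) -
    scale k c * quasi_volume (fun x =>
      \int[jordan_neg (hahn_pair mu)]_(t in hcube) mars_kernel x t) (low k c) (high k c))).
    by apply: cvgB; apply: kernel_quotient_cvg => // A mA A0; have [] := jordan_carried cmu mA A0.
  by apply/funext => k; rewrite -mulrBr -quasi_volumeB.
have := lim _ cnu; rewrite (_ : (fun k => _) = (fun k => scale k c *
    quasi_volume (fun x => charge_integral nu' hcube (mars_kernel x)) (low k c) (high k c))).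
  by move=> l; apply: (cvg_unique _ l (lim _ cnu')).
apply/funext => k; congr (_ * _); apply: eq_quasi_volume => x hx; apply: E.
exact: (corner_cube cc hx).
Qed.

End uniqueness.

(** * The two representations of a function and its complexity *)

Section representations.
Context {R : realType} {d s : nat}.
Implicit Types (f : d.-tuple R -> R) (nu : @measure_family R d) (g : @density_family R d).

Lemma charge_integral_eq0 n (nu : {charge set (n.-tuple (measurableTypeR R)) -> \bar R})
    (h : n.-tuple (measurableTypeR R) -> R) :
  (forall t, hcube t -> h t = 0) -> charge_integral nu hcube h = 0.
Proof.
move=> h0; have int0 (mu : {measure set (n.-tuple (measurableTypeR R)) -> \bar R}) :
    \int[mu]_(t in hcube) h t = 0.
  rewrite (@eq_Rintegral _ _ _ mu _ (cst 0)); last by move=> t /set_mem; exact: h0.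
  by rewrite Rintegral_cst ?mul0r//; exact: measurable_hcube.
by rewrite /charge_integral !int0 subrr.
Qed.

Lemma sub_tuple_face (A : {set 'I_d}) (y : #|A|.-tuple R) : sub_tuple A (face y) = y.
Proof. by apply: eq_from_tnth => i; rewrite tnth_sub_tuple tnth_face_val. Qed.

Lemma charge_integral_kernel_face0 (A : {set 'I_d}) (x : d.-tuple R) j
    (nu : {charge set (#|A|.-tuple (measurableTypeR R)) -> \bar R}) :
  j \in A -> tnth x j = 0 -> charge_integral nu hcube (mars_kernel (sub_tuple A x)) = 0.
Proof.
move=> jA xj; apply: charge_integral_eq0 => t th; rewrite /mars_kernel.
rewrite (bigD1 (enum_rank_in jA j))//= tnth_sub_tuple enum_rankK_in// xj sub0r.
rewrite [X in X * _](_ : _ = 0) ?mul0r//; apply/max_idPr.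
by rewrite oppr_le0; have /andP[] := th (enum_rank_in jA j).
Qed.

Lemma mars_repr_origin f a0 nu : mars_repr s f a0 nu -> f (Defs.tuple0 d) = a0.
Proof.
move=> [_ ->]; last by apply/cubeP => i; rewrite tnth_mktuple lexx ler01.
rewrite /mars_fun big1 ?addr0// => A /andP[/card_gt0P[j jA] _].
by apply: charge_integral_kernel_face0 jA _; rewrite tnth_mktuple.
Qed.

(** The constant is the value at the origin. At a point of the face of [A], a term [B] not contained
    in [A] vanishes through a factor [(0 - t_j)_+], and a term with [B] properly contained in [A] is
    settled by induction on the cardinality, so the terms of [A] agree. *)
Lemma mars_repr_unique f a0 nu a0' nu' :
  mars_repr s f a0 nu -> mars_repr s f a0' nu' ->
  forall A, mars_index s A ->
  forall x, cube x -> charge_density (nu A) x = charge_density (nu' A) x.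
Proof.
move=> rep rep'; have aa' : a0 = a0'.
  by rewrite -(mars_repr_origin rep) -(mars_repr_origin rep').
have [adm fE] := rep; have [adm' fE'] := rep'.
suff E n (A : {set 'I_d}) : (#|A| <= n)%N -> mars_index s A -> forall y, cube y ->
    charge_integral (nu A) hcube (mars_kernel y) =
    charge_integral (nu' A) hcube (mars_kernel y).
  by move=> A sA; apply: charge_density_unique (adm A sA) (adm' A sA) (E _ A (leqnn _) sA).
elim: n A => [|n IH] A An sA y cy.
  by case/andP: sA => A0 _; have := leq_trans A0 An.
have cx := cube_face cy; have := fE _ cx; rewrite (fE' _ cx) /mars_fun aa' => /addrI.
rewrite (bigD1 A)//= [in RHS](bigD1 A)//= !sub_tuple_face => E.
suff eq_rest : \sum_(B | mars_index s B && (B != A))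
      charge_integral (nu' B) hcube (mars_kernel (sub_tuple B (face y))) =
    \sum_(B | mars_index s B && (B != A))
      charge_integral (nu B) hcube (mars_kernel (sub_tuple B (face y))).
  by move: E; rewrite -!/(mars_kernel _) eq_rest => /addIr.
apply: eq_bigr => B /andP[sB BA]; have [sBA|/subsetPn[j jB jA]] := boolP (B \subset A).
  apply/esym/IH => //; last exact: sub_tuple_cube.
  by rewrite -ltnS (leq_trans _ An)// proper_card// finset.properEneq BA sBA.
by rewrite !(@charge_integral_kernel_face0 B (face y) j) ?tnth_face_out.
Qed.

Lemma mars_repr_density f a0 nu : mars_repr s f a0 nu ->
  admissible_densities s (fun A => charge_density (nu A)) /\
  density_repr s f a0 (fun A => charge_density (nu A)).
Proof.
move=> [adm fE]; split.
  move=> A sA; have cA := adm A sA; split.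
  - apply: le_lt_trans (VHK0_le_total_variation cA _) _ => //.
    by apply: total_variation_lty; exact: measurable_hcube_punctured.
  - exact: charge_density_right_continuous.
  - exact: charge_density_left_continuous_at1.
move=> x cx; rewrite fE//; congr (_ + _); apply: eq_bigr => A sA.
by apply: charge_integral_kernel => //; [exact: adm|exact: sub_tuple_cube].
Qed.

Lemma density_mars_repr f a0 g : admissible_densities s g -> density_repr s f a0 g ->
  exists2 nu, mars_repr s f a0 nu & forall A, mars_index s A ->
    forall x, cube x -> g A x = charge_density (nu A) x.
Proof.
move=> adm fE.
have ex (A : {set 'I_d}) : exists nu : {charge set (#|A|.-tuple (measurableTypeR R)) -> \bar R},
    mars_index s A ->
    carried_by nu hcube /\ forall x, cube x -> g A x = charge_density nu x.
  (* A family has a member for every set of coordinates; the zero charge fills the indices that do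
     not occur in the sum. *)
  have [sA|_] := boolP (mars_index s A); last by exists czero.
  have [gV rc lc] := adm A sA.
  by have [nu cnu nuE] := density_charge_ex gV rc lc; exists nu => _; split=> // x /nuE.
pose nu (A : {set 'I_d}) := sval (cid (ex A)).
have nuP (A : {set 'I_d}) : mars_index s A -> carried_by (nu A) hcube /\
    forall x, cube x -> g A x = charge_density (nu A) x by exact: (svalP (cid (ex A))).
exists nu; last by move=> A /nuP[].
split; first by move=> A /nuP[].
move=> x cx; rewrite fE//; congr (_ + _); apply: eq_bigr => A sA.
have [cA gE] := nuP A sA.
by apply/esym/charge_integral_kernel => //; exact: sub_tuple_cube.
Qed.

(** The given [nu] need not be the family built from [g], but its distribution functions are the
    same, and these alone determine the variations off the origin. *)
Lemma mars_complexity_density f a0 g a0' nu :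
  admissible_densities s g -> density_repr s f a0 g -> mars_repr s f a0' nu ->
  mars_complexity s nu = (\sum_(A : {set 'I_d} | mars_index s A) VHK0 (g A))%E.
Proof.
move=> adm fE rep; have [nu' rep' gE] := density_mars_repr adm fE.
apply: eq_bigr => A sA; have [gV rc lc] := adm A sA; have [cnu _] := rep.
apply/esym/VHK0_total_variation => //; first exact: cnu.
by move=> x cx; rewrite gE// (mars_repr_unique rep' rep).
Qed.

End representations.

Theorem proposition4p1 (R : realType) (d s : nat)
    (hs : (1 <= s)%N) (hsd : (s <= d)%N) :
  (forall f : d.-tuple R -> R,
      mars_class s f <->
      exists (a0 : R) (g : @density_family R d),
        admissible_densities s g /\ density_repr s f a0 g) /\
  (forall (f : d.-tuple R -> R) (a0 : R) (g : @density_family R d),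
      admissible_densities s g -> density_repr s f a0 g ->
      Vmars s f = (\sum_(A : {set 'I_d} | mars_index s A) VHK0 (g A))%E).

Proof.
split=> [f|f a0 g adm fE].
  split=> [[a0 [nu /mars_repr_density[adm fE]]]|[a0 [g [adm fE]]]].
    by exists a0, (fun A => charge_density (nu A)).
  by have [nu rep _] := density_mars_repr adm fE; exists a0, nu.
(* Whichever representation the choice picks, its complexity is the sum for [g]; the default 0 is
   excluded because [g] yields a representation. *)
rewrite /Vmars; case: xgetP => [_ _ [a0' [nu [rep ->]]]|none].
  exact: mars_complexity_density adm fE rep.
have [nu rep _] := density_mars_repr adm fE.
by case: (none (mars_complexity s nu)); exists a0, nu.
Qed.
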